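(* For every $\gamma>0$, the class $\mathcal{S}(\gamma)$ is not closed under convolution roots; that is, there exist a distribution $\mu$ on $\mathbb{R}$ and $n\in\mathbb{N}$ such that $\mu^{n*}\in\mathcal{S}(\gamma)$ but $\mu\notin\mathcal{S}(\gamma)$.
   Context: For a probability distribution $\rho$ on $\mathbb{R}$: $\bar\rho(x):=\rho((x,\infty))$ is its tail, $\rho^{n*}$ its $n$-th convolution power, and for $\gamma\in\mathbb{R}$, $\widehat\rho(\gamma):=\int_{-\infty}^\infty e^{\gamma x}\rho(dx)$ (and, when this is finite, $\widehat\rho(\gamma+iz):=\int e^{(\gamma+iz)x}\rho(dx)$ for $z\in\mathbb{R}$). For positive functions, $f\sim g$ means $f(x)/g(x)\to1$ as $x\to\infty$. Let $\gamma\ge0$. $\rho\in\mathcal{L}(\gamma)$ if $\bar\rho(x)>0$ for all $x\in\mathbb{R}$ and $\bar\rho(x+a)\sim e^{-\gamma a}\bar\rho(x)$ for every $a\in\mathbb{R}$. $\rho\in\mathcal{S}(\gamma)$ if $\rho\in\mathcal{L}(\gamma)$, $\widehat\rho(\gamma)<\infty$, and $\overline{\rho^{2*}}(x)\sim2\widehat\rho(\gamma)\bar\rho(x)$. A class $\mathcal{C}$ of distributions on $\mathbb{R}$ is closed under convolution roots if $\mu^{n*}\in\mathcal{C}$ for some $n\in\mathbb{N}$ implies $\mu\in\mathcal{C}$. *)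

(* Defs.v *)
From Stdlib Require Import Reals Lra.
Open Scope R_scope.

Inductive borel : (R -> Prop) -> Prop :=
| borel_interval (a b : R) : borel (fun x => a < x < b)
| borel_compl (A : R -> Prop) : borel A -> borel (fun x => ~ A x)
| borel_cunion (A : nat -> R -> Prop) :
    (forall n, borel (A n)) -> borel (fun x => exists n, A n x).

(** Probability distributions on R (Borel probability measures).
    The set function is only meaningful on Borel sets. *)
Record distr := {
  pm :> (R -> Prop) -> R;
  pm_ext : forall A B : R -> Prop, (forall x, A x <-> B x) -> pm A = pm B;
  pm_nonneg : forall A, borel A -> 0 <= pm A;
  pm_total : pm (fun _ => True) = 1;
  pm_sigma : forall A : nat -> R -> Prop,
      (forall n, borel (A n)) ->
      (forall n m x, A n x -> A m x -> n = m) ->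
      infinite_sum (fun n => pm (A n)) (pm (fun x => exists n, A n x))
}.

Definition distr_eq (mu nu : distr) : Prop :=
  forall A, borel A -> mu A = nu A.

Definition tail (rho : distr) (x : R) : R := rho (fun y => x < y).

(** [integral_is rho f L]: the (Lebesgue) integral of the nonnegative
    (measurable) function f w.r.t. rho is finite and equals L; defined by the
    layer-cake formula  int f drho = int_0^infty rho({f > t}) dt, the improper
    Riemann integral being the supremum over T >= 0 of int_0^T. *)
Definition integral_is (rho : distr) (f : R -> R) (L : R) : Prop :=
  is_lub (fun v => exists (T : R)
            (pr : Riemann_integrable (fun t => rho (fun x => t < f x)) 0 T),
            0 <= T /\ v = RiemannInt pr) L.

Definition laplace_is (rho : distr) (g L : R) : Prop :=
  integral_is rho (fun x => exp (g * x)) L.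

Definition is_conv (mu nu rho : distr) : Prop :=
  forall A, borel A -> integral_is nu (fun y => mu (fun x => A (x + y))) (rho A).

Inductive convpow (mu : distr) : nat -> distr -> Prop :=
| convpow1 (rho : distr) : distr_eq mu rho -> convpow mu 1 rho
| convpowS (n : nat) (sigma rho : distr) :
    convpow mu n sigma -> is_conv sigma mu rho -> convpow mu (S n) rho.

Definition asymp (f g : R -> R) : Prop :=
  forall eps, 0 < eps -> exists M, forall x, M < x -> Rabs (f x / g x - 1) < eps.

Definition inL (g : R) (rho : distr) : Prop :=
  (forall x, 0 < tail rho x) /\
  (forall a, asymp (fun x => tail rho (x + a)) (fun x => exp (- g * a) * tail rho x)).

Definition inS (g : R) (rho : distr) : Prop :=
  inL g rho /\
  exists m : R, laplace_is rho g m /\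
    exists rho2 : distr, is_conv rho rho rho2 /\
      asymp (tail rho2) (fun x => 2 * m * tail rho x).

(* Main.v *)
(** Take [mu] with [mu((x,oo)) ~ c e^(-g x) (2 + cos (g x)) / (1 + x)^2], plus a
    few atoms near the origin chosen so that the transform of [mu] vanishes at
    [g + i g].  The tail of [mu] oscillates, so [mu] is not in [L(g)].  By dominated
    convergence the tail of [mu * mu] is
    [~ 2 c e^(-g x) (1 + x)^(-2) int e^(g y) (2 + cos (g (x - y))) mu(dy)], and the
    vanishing of the transform removes the oscillation: the tail of [mu * mu] is
    [~ C e^(-g x) (1 + x)^(-2)], which puts it in [S(g)].  The measure [mu] is
    atomic, carried by the points [sqrt n], whose gaps tend to [0]; integrals
    against it are series. *)

Require Import Defs.
From Stdlib Require Import Reals Lra Lia.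
From Stdlib Require Import ClassicalEpsilon FunctionalExtensionality.
From Coquelicot Require Import Coquelicot.
Open Scope R_scope.

(** The factor [(1 + x)^(-2)] does two jobs. It makes the moment of order [g] finite, and it makes
    the event that both summands exceed [x / 2] negligible: there the two exponentials multiply back
    to [exp (- g x)], while the polynomial factor gets squared. The shape [2 + cos] makes
    [exp (- g x) (2 + cos (g x))] positive and decreasing, hence a possible tail. The gaps must
    shrink because a tail that stays constant on intervals of a fixed length arbitrarily far out
    cannot follow [exp (- g x)]. Four extra atoms suffice: at [g x = 0, PI/2, PI, 3 PI/2] the
    vectors [(cos, sin)] point along the four half-axes, so nonnegative masses there cancel any
    complex number, and beyond the last of them the tail changes only by the normalisation. Since
    integrals are defined by layers, the expectations have to be matched with Riemann integrals of
    functions [t -> rho (f > t)], which are monotone but jump. *)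

Definition ind (P : Prop) : R := if excluded_middle_informative P then 1 else 0.

Lemma ind_true (P : Prop) : P -> ind P = 1.
Proof. intros H; unfold ind; destruct (excluded_middle_informative P); tauto. Qed.

Lemma ind_false (P : Prop) : ~ P -> ind P = 0.
Proof. intros H; unfold ind; destruct (excluded_middle_informative P); tauto. Qed.

Lemma ind_bounds (P : Prop) : 0 <= ind P <= 1.
Proof. unfold ind; destruct (excluded_middle_informative P); lra. Qed.

Lemma ind_le (P Q : Prop) : (P -> Q) -> ind P <= ind Q.
Proof.
intros H; unfold ind.
destruct (excluded_middle_informative P); destruct (excluded_middle_informative Q);
  try lra; tauto.
Qed.

Lemma ind_iff (P Q : Prop) : (P <-> Q) -> ind P = ind Q.
Proof. intros H; apply Rle_antisym; apply ind_le; tauto. Qed.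

(** * Riemann integrals of decreasing functions *)

(** On [[0, T]] the indicator of a down-closed set is a step with a single jump, at the supremum of
    the set. *)
Lemma ex_RInt_down_set (P : R -> Prop) (T : R) :
  (forall s t, s <= t -> P t -> P s) -> 0 <= T -> ex_RInt (fun t => ind (P t)) 0 T.
Proof.
intros HP HT.
(* The disjunct [t = 0] keeps the set nonempty when [P] fails on all of [[0, T]]; then [c = 0] and
   the left piece is degenerate. *)
destruct (completeness (fun t => 0 <= t <= T /\ (t = 0 \/ P t))) as [c [Hub Hlub]].
- exists T; intros t [H _]; lra.
- exists 0; split; [lra | now left].
- assert (Hc0 : 0 <= c) by (apply Hub; split; [lra | now left]).
  assert (HcT : c <= T) by (apply Hlub; intros t [H _]; lra).
  apply ex_RInt_Chasles with c.
  + apply ex_RInt_ext with (fun _ => 1); [| apply ex_RInt_const].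
    intros t [Ht1 Ht2]; rewrite Rmin_left in Ht1 by lra; rewrite Rmax_right in Ht2 by lra.
    symmetry; apply ind_true, NNPP; intros Hn.
    assert (c <= t); [apply Hlub | lra].
    intros s [Hs [-> | HPs]]; [lra |].
    destruct (Rle_dec s t) as [|Hst]; [assumption | exfalso].
    apply Hn, (HP t s); [lra | assumption].
  + apply ex_RInt_ext with (fun _ => 0); [| apply ex_RInt_const].
    intros t [Ht1 Ht2]; rewrite Rmin_left in Ht1 by lra; rewrite Rmax_right in Ht2 by lra.
    symmetry; apply ind_false; intros Hn.
    assert (t <= c); [apply Hub | lra].
    split; [lra | now right].
Qed.

(** A staircase approximation of [y] from below, with at most [k] steps of height [h]. It is a sum
    of indicators so that, for [y = phi t] with [phi] decreasing, each summand is the indicator of a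
    down-closed set of [t]. *)
Fixpoint layers (h y : R) (k : nat) : R :=
  match k with
  | O => 0
  | S k => layers h y k + h * ind (INR (S k) * h < y)
  end.

Lemma layers_bounds (h y : R) (k : nat) : 0 < h -> 0 <= y ->
  (INR k * h < y -> layers h y k = INR k * h) /\
  (y <= INR k * h -> y - h <= layers h y k <= y).
Proof.
intros Hh Hy; induction k as [|k [IH1 IH2]]; cbn [layers].
- simpl; split; intros; lra.
- rewrite S_INR; split; intros H.
  + rewrite ind_true by lra; rewrite IH1 by lra; lra.
  + rewrite ind_false by lra.
    destruct (Rlt_le_dec (INR k * h) y) as [H'|H'].
    * rewrite IH1 by lra; lra.
    * specialize (IH2 H'); lra.
Qed.

(** With values in [[0, 1]], [n + 1] steps of height [1 / (n + 1)] approximate [phi] within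
    [1 / (n + 1)] at every [t], and a uniform limit of integrable functions is integrable. *)
Lemma ex_RInt_antitone (phi : R -> R) (T : R) :
  (forall s t, s <= t -> phi t <= phi s) -> (forall t, 0 <= phi t <= 1) -> 0 <= T ->
  ex_RInt phi 0 T.
Proof.
intros Hdec Hb HT.
pose (f := fun (n : nat) (t : R) => layers (/ INR (S n)) (phi t) (S n)).
assert (Hf : forall n, ex_RInt (f n) 0 T).
{ intros n; unfold f; generalize (S n) at 2; generalize (/ INR (S n)); intros h k.
  induction k as [|k IH]; cbn [layers]; [apply ex_RInt_const |].
  apply @ex_RInt_plus; [exact IH |].
  apply @ex_RInt_scal, (ex_RInt_down_set (fun t => INR (S k) * h < phi t)); [| assumption].
  intros s t Hst H; specialize (Hdec s t Hst); lra. }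
destruct (filterlim_RInt f 0 T eventually _ phi (fun n => RInt (f n) 0 T)) as [I [_ HI]].
- intros n; apply @RInt_correct, Hf.
- apply filterlim_locally; intros eps.
  destruct (nfloor_ex (/ eps)) as [N HN]; [left; apply Rinv_0_lt_compat, cond_pos |].
  exists N; intros n Hn t.
  assert (HSn : 0 < INR (S n)) by (apply lt_0_INR; lia).
  assert (Hlt : / INR (S n) < eps).
  { rewrite <- (Rinv_inv eps); apply Rinv_lt_contravar.
    - apply Rmult_lt_0_compat; [apply Rinv_0_lt_compat, cond_pos | assumption].
    - apply Rlt_le_trans with (INR N + 1); [tauto |].
      rewrite <- S_INR; apply le_INR; lia. }
  destruct (layers_bounds (/ INR (S n)) (phi t) (S n)) as [_ H].
  + now apply Rinv_0_lt_compat.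
  + apply Hb.
  + rewrite Rinv_r in H by lra; specialize (H (proj2 (Hb t))).
    change (Rabs (f n t - phi t) < eps); unfold f.
    apply Rabs_def1; lra.
- now exists I.
Qed.

(** A fundamental theorem of calculus for an integrand that may jump. The difference [D] of [G] and
    the integral has increments at most [(t - s) * (phi s - phi t)]; along a grid of mesh [h] these
    bounds telescope to at most [h], and [h] is arbitrarily small. *)
Lemma RInt_antitone_sandwich (phi G : R -> R) (T : R) :
  (forall s t, s <= t -> phi t <= phi s) -> (forall t, 0 <= phi t <= 1) -> 0 <= T ->
  (forall s t, s <= t -> (t - s) * phi t <= G t - G s <= (t - s) * phi s) ->
  RInt phi 0 T = G T - G 0.
Proof.
intros Hdec Hb HT HG.
pose (D := fun t => G t - RInt phi 0 t).
assert (Hex : forall s t, 0 <= s <= t -> ex_RInt phi s t).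
{ intros s t Hst; apply @ex_RInt_Chasles_2 with 0; [lra |].
  apply ex_RInt_antitone; trivial; lra. }
assert (HD : forall s t, 0 <= s <= t -> Rabs (D t - D s) <= (t - s) * (phi s - phi t)).
{ intros s t Hst; unfold D.
  assert (HC : RInt phi 0 t = RInt phi 0 s + RInt phi s t).
  { symmetry; apply (RInt_Chasles phi 0 s t); apply Hex; lra. }
  assert (Hle : forall c d, (forall u, s < u < t -> c <= phi u <= d) ->
     (t - s) * c <= RInt phi s t <= (t - s) * d).
  { intros c d Hcd; split.
    - rewrite <- (RInt_const (V := R_CompleteNormedModule) s t c : _ = (t - s) * c).
      apply RInt_le; try lra; [apply ex_RInt_const | apply Hex; lra | intros; now apply Hcd].
    - rewrite <- (RInt_const (V := R_CompleteNormedModule) s t d : _ = (t - s) * d).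
      apply RInt_le; try lra; [apply Hex; lra | apply ex_RInt_const | intros; now apply Hcd]. }
  destruct (Hle (phi t) (phi s)) as [H1 H2].
  { intros u Hu; split; apply Hdec; lra. }
  destruct (HG s t) as [H3 H4]; [lra |].
  rewrite HC; apply Rabs_le; lra. }
assert (HD0 : D 0 = G 0) by (unfold D; rewrite RInt_point; unfold zero; simpl; lra).
assert (Hsum : forall h k, 0 <= h ->
  Rabs (D (INR k * h) - D 0) <= h * (phi 0 - phi (INR k * h))).
{ intros h k Hh; induction k as [|k IH].
  - simpl; rewrite Rmult_0_l, Rminus_diag, Rabs_R0; lra.
  - specialize (HD (INR k * h) (INR (S k) * h)).
    replace (D (INR (S k) * h) - D 0)
      with ((D (INR (S k) * h) - D (INR k * h)) + (D (INR k * h) - D 0)) by ring.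
    eapply Rle_trans; [apply Rabs_triang |].
    assert (0 <= INR k * h) by (apply Rmult_le_pos; [apply pos_INR | assumption]).
    rewrite S_INR in *; lra. }
assert (HDT : Rabs (D T - D 0) <= 0).
{ apply le_epsilon; intros eps Heps.
  destruct (nfloor_ex (T / eps)) as [N HN].
  { apply Rmult_le_pos; [assumption | left; now apply Rinv_0_lt_compat]. }
  assert (HS : 0 < INR (S N)) by (apply lt_0_INR; lia).
  specialize (Hsum (T / INR (S N)) (S N)).
  assert (Hh : 0 <= T / INR (S N))
    by (apply Rmult_le_pos; [assumption | left; now apply Rinv_0_lt_compat]).
  specialize (Hsum Hh).
  replace (INR (S N) * (T / INR (S N))) with T in Hsum by (field; lra).
  pose proof (Hb 0); pose proof (Hb T).
  apply Rle_trans with (1 := Hsum), Rle_trans with (T / INR (S N) * 1).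
  { apply Rmult_le_compat_l; lra. }
  rewrite Rplus_0_l, Rmult_1_r.
  apply Rmult_le_reg_r with (INR (S N)); [assumption |].
  unfold Rdiv; rewrite Rmult_assoc, Rinv_l, Rmult_1_r by lra.
  rewrite S_INR.
  apply Rmult_le_reg_r with (/ eps); [now apply Rinv_0_lt_compat |].
  replace (eps * (INR N + 1) * / eps) with (INR N + 1) by (field; lra).
  unfold Rdiv in HN; lra. }
pose proof (Rabs_pos (D T - D 0)).
assert (E : D T - D 0 = 0).
{ destruct (Req_dec (D T - D 0) 0) as [|Hne]; [assumption |].
  apply Rabs_pos_lt in Hne; lra. }
rewrite HD0 in E; unfold D in E; lra.
Qed.

Lemma exp_le_compat (x y : R) : x <= y -> exp x <= exp y.
Proof.
intros [H | ->]; [left; now apply exp_increasing | right; reflexivity].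
Qed.

(** * Expectation functionals *)

(** It dominates both the constants and [exp (g * x)], and it is submultiplicative, which is what
    lets domination pass to convolutions. *)
Definition weight (g x : R) : R := 1 + exp (g * x).

Lemma weight_ge_1 (g x : R) : 1 <= weight g x.
Proof. unfold weight; pose proof (exp_pos (g * x)); lra. Qed.

Lemma exp_le_weight (g x : R) : exp (g * x) <= weight g x.
Proof. unfold weight; lra. Qed.

Lemma weight_plus (g x y : R) : weight g (x + y) <= weight g x * weight g y.
Proof.
unfold weight; rewrite Rmult_plus_distr_l, exp_plus.
pose proof (exp_pos (g * x)); pose proof (exp_pos (g * y)); nra.
Qed.

Definition dominated (g : R) (f : R -> R) : Prop :=
  exists C, forall x, Rabs (f x) <= C * weight g x.

Lemma dominated_bounded (g C : R) (f : R -> R) : (forall x, Rabs (f x) <= C) -> dominated g f.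
Proof.
intros H; exists C; intros x.
pose proof (weight_ge_1 g x); pose proof (Rabs_pos (f x)); specialize (H x); nra.
Qed.

Lemma dominated_const (g c : R) : dominated g (fun _ => c).
Proof. apply dominated_bounded with (Rabs c); intros; lra. Qed.

Lemma dominated_ind (g : R) (A : R -> Prop) : dominated g (fun x => ind (A x)).
Proof.
apply dominated_bounded with 1; intros x.
pose proof (ind_bounds (A x)); rewrite Rabs_pos_eq; lra.
Qed.

Lemma dominated_plus (g : R) (f h : R -> R) :
  dominated g f -> dominated g h -> dominated g (fun x => f x + h x).
Proof.
intros [C HC] [D HD]; exists (C + D); intros x.
eapply Rle_trans; [apply Rabs_triang |].
specialize (HC x); specialize (HD x); lra.
Qed.

Lemma dominated_scal (g c : R) (f : R -> R) : dominated g f -> dominated g (fun x => c * f x).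
Proof.
intros [C HC]; exists (Rabs c * C); intros x.
rewrite Rabs_mult, Rmult_assoc; apply Rmult_le_compat_l; [apply Rabs_pos | apply HC].
Qed.

Lemma dominated_minus (g : R) (f h : R -> R) :
  dominated g f -> dominated g h -> dominated g (fun x => f x - h x).
Proof.
intros Hf Hh.
replace (fun x => f x - h x) with (fun x => f x + (-1) * h x)
  by (apply functional_extensionality; intros; ring).
apply dominated_plus; [| apply dominated_scal]; assumption.
Qed.

Lemma dominated_weight (g : R) : dominated g (weight g).
Proof.
exists 1; intros x; rewrite Rabs_pos_eq; pose proof (weight_ge_1 g x); lra.
Qed.

Lemma dominated_exp_mult (g C : R) (p : R -> R) :
  (forall y, Rabs (p y) <= C) -> dominated g (fun y => exp (g * y) * p y).
Proof.
intros Hp; exists C; intros y.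
rewrite Rabs_mult, (Rabs_pos_eq (exp _)) by (left; apply exp_pos).
pose proof (exp_pos (g * y)); pose proof (exp_le_weight g y).
pose proof (Rabs_pos (p y)); specialize (Hp y); nra.
Qed.

(** A distribution with finite exponential moment of order [g] is represented by
    its expectation functional, used only on functions dominated by
    [1 + exp (g x)]; all distributions below are atomic, so no measurability
    is involved. *)
Record expectation (g : R) (E : (R -> R) -> R) : Prop := {
  expect_plus : forall f h, dominated g f -> dominated g h ->
    E (fun x => f x + h x) = E f + E h;
  expect_scal : forall c f, dominated g f -> E (fun x => c * f x) = c * E f;
  expect_pos : forall f, dominated g f -> (forall x, 0 <= f x) -> 0 <= E f;
  expect_one : E (fun _ => 1) = 1;
  expect_dct : forall (T : Type) (F : (T -> Prop) -> Prop) (f : T -> R -> R) (C : R),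
    Filter F -> (forall t x, Rabs (f t x) <= C * weight g x) ->
    (forall x eps, 0 < eps -> F (fun t => Rabs (f t x) < eps)) ->
    forall eps, 0 < eps -> F (fun t => Rabs (E (f t)) < eps)
}.

(** The exchange is asked against every other expectation functional, so it is a property on top of
    [expectation]; it holds for series and survives [convolve]. *)
Definition fubini (g : R) (E : (R -> R) -> R) : Prop :=
  forall E', expectation g E' -> forall (f : R -> R -> R) (C : R),
    (forall x y, Rabs (f x y) <= C * (weight g x * weight g y)) ->
    E (fun x => E' (fun y => f x y)) = E' (fun y => E (fun x => f x y)).

Definition convolve (E1 E2 : (R -> R) -> R) (f : R -> R) : R :=
  E2 (fun y => E1 (fun x => f (x + y))).

Definition atomic (w z : nat -> R) (f : R -> R) : R := Series (fun n => w n * f (z n)).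

Section Expectation.
Context {g : R} {E : (R -> R) -> R} (HE : expectation g E).

Lemma expect_const (c : R) : E (fun _ => c) = c.
Proof.
replace (fun _ : R => c) with (fun x : R => c * (fun _ => 1) x)
  by (apply functional_extensionality; intros; ring).
rewrite (expect_scal _ _ HE), (expect_one _ _ HE); [ring | apply dominated_const].
Qed.

Lemma expect_minus (f h : R -> R) : dominated g f -> dominated g h ->
  E (fun x => f x - h x) = E f - E h.
Proof.
intros Hf Hh.
replace (fun x => f x - h x) with (fun x => f x + (-1) * h x)
  by (apply functional_extensionality; intros; ring).
rewrite (expect_plus _ _ HE), (expect_scal _ _ HE); auto using dominated_scal; ring.
Qed.

Lemma expect_le (f h : R -> R) : dominated g f -> dominated g h ->
  (forall x, f x <= h x) -> E f <= E h.
Proof.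
intros Hf Hh H.
assert (0 <= E (fun x => h x - f x)).
{ apply (expect_pos _ _ HE); [now apply dominated_minus | intros x; specialize (H x); lra]. }
rewrite expect_minus in *; auto; lra.
Qed.

Lemma expect_abs_le (f h : R -> R) : dominated g h ->
  (forall x, Rabs (f x) <= h x) -> Rabs (E f) <= E h.
Proof.
intros Hh H.
assert (Hf : dominated g f).
{ destruct Hh as [C HC]; exists C; intros x; eapply Rle_trans, HC.
  eapply Rle_trans; [apply H | apply Rle_abs]. }
apply Rabs_le; split.
- replace (- E h) with (-1 * E h) by ring.
  rewrite <- (expect_scal _ _ HE) by assumption.
  apply expect_le; auto using dominated_scal.
  intros x; specialize (H x); apply Rabs_le_between in H; lra.
- apply expect_le; auto.
  intros x; eapply Rle_trans; [apply Rle_abs | apply H].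
Qed.

Lemma expect_abs_weight (f : R -> R) (C : R) : (forall x, Rabs (f x) <= C * weight g x) ->
  Rabs (E f) <= C * E (weight g).
Proof.
intros H; rewrite <- (expect_scal _ _ HE) by apply dominated_weight.
apply expect_abs_le; auto using dominated_scal, dominated_weight.
Qed.

(** The indicators of [exp (g * y) < 1 / (n + 1)] tend to [0] pointwise, so one of them has
    expectation below [1]. Taking expectations in [1 / (n + 1) <= exp (g * y) + 1 / (n + 1) *
    indicator] then leaves a positive amount for the exponential. *)
Lemma expect_exp_pos : 0 < E (fun y => exp (g * y)).
Proof.
pose (f := fun (n : nat) (y : R) => ind (exp (g * y) < / INR (S n))).
assert (Hlim : eventually (fun n => Rabs (E (f n)) < 1)).
{ refine (expect_dct _ _ HE nat eventually f 1 _ _ _ 1 Rlt_0_1).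
  - intros n x; unfold f; pose proof (weight_ge_1 g x).
    pose proof (ind_bounds (exp (g * x) < / INR (S n))); rewrite Rabs_pos_eq; lra.
  - intros y eps Heps.
    destruct (nfloor_ex (/ exp (g * y))) as [N HN];
      [left; apply Rinv_0_lt_compat, exp_pos |].
    exists N; intros n Hn; unfold f.
    rewrite ind_false; [rewrite Rabs_R0; assumption |].
    apply Rle_not_lt; rewrite <- (Rinv_inv (exp (g * y))).
    apply Rinv_le_contravar; [apply Rinv_0_lt_compat, exp_pos |].
    rewrite S_INR; apply le_INR in Hn; lra. }
destruct Hlim as [N HN]; specialize (HN N (le_n N)).
assert (Hp : 0 < / INR (S N)) by (apply Rinv_0_lt_compat, lt_0_INR; lia).
assert (Hdom : dominated g (fun y => / INR (S N) * ind (exp (g * y) < / INR (S N))))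
  by apply dominated_scal, (dominated_ind g (fun y => exp (g * y) < / INR (S N))).
assert (Hexp : dominated g (fun y => exp (g * y))).
{ replace (fun y => exp (g * y)) with (fun y => exp (g * y) * 1)
    by (apply functional_extensionality; intros; ring).
  apply dominated_exp_mult with 1; intros; rewrite Rabs_R1; lra. }
assert (H : / INR (S N) <= E (fun y => exp (g * y) + / INR (S N) * f N y)).
{ rewrite <- (expect_const (/ INR (S N))) at 1; apply expect_le;
    [apply dominated_const | now apply dominated_plus |].
  intros y; unfold f; pose proof (exp_pos (g * y)).
  destruct (Rlt_le_dec (exp (g * y)) (/ INR (S N))).
  - rewrite ind_true by assumption; lra.
  - rewrite ind_false by lra; lra. }
rewrite (expect_plus _ _ HE), (expect_scal _ _ HE) in H; auto.
- apply Rabs_def2 in HN; nra.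
- apply (dominated_ind g (fun y => exp (g * y) < / INR (S N))).
Qed.

End Expectation.

Lemma dominated_inner (g C : R) (E : (R -> R) -> R) (f : R -> R -> R) :
  expectation g E -> (forall x y, Rabs (f x y) <= C * (weight g x * weight g y)) ->
  forall y, Rabs (E (fun x => f x y)) <= C * E (weight g) * weight g y.
Proof.
intros HE Hf y.
replace (C * E (weight g) * weight g y) with (C * weight g y * E (weight g)) by ring.
apply (expect_abs_weight HE); intros x.
specialize (Hf x y); lra.
Qed.

Lemma dominated_shift (g C : R) (f : R -> R) : (forall x, Rabs (f x) <= C * weight g x) ->
  forall x y, Rabs (f (x + y)) <= C * (weight g x * weight g y).
Proof.
intros Hf x y; eapply Rle_trans; [apply Hf |].
assert (0 <= C).
{ specialize (Hf 0); pose proof (Rabs_pos (f 0)); pose proof (weight_ge_1 g 0).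
  apply Rmult_le_reg_r with (weight g 0); lra. }
apply Rmult_le_compat_l; [assumption | apply weight_plus].
Qed.

(** Submultiplicativity of [weight] bounds the inner expectation by a multiple of [weight g y];
    dominated convergence is then applied twice, inside for fixed [y] and outside with the constant
    [C * E1 (weight g)]. *)
Lemma expectation_convolve (g : R) (E1 E2 : (R -> R) -> R) :
  expectation g E1 -> expectation g E2 -> expectation g (convolve E1 E2).
Proof.
intros H1 H2; unfold convolve.
assert (Hin : forall f y, dominated g f -> dominated g (fun x => f (x + y))).
{ intros f y [C HC]; exists (C * weight g y); intros x.
  pose proof (dominated_shift g C f HC x y); lra. }
assert (Hout : forall f, dominated g f -> dominated g (fun y => E1 (fun x => f (x + y)))).
{ intros f [C HC]; exists (C * E1 (weight g)).
  apply (dominated_inner g C E1 (fun x y => f (x + y))); trivial.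
  now apply dominated_shift. }
split.
- intros f h Hf Hh; rewrite <- (expect_plus _ _ H2) by auto.
  f_equal; apply functional_extensionality; intros y.
  apply (expect_plus _ _ H1); now apply Hin.
- intros c f Hf; rewrite <- (expect_scal _ _ H2) by auto.
  f_equal; apply functional_extensionality; intros y.
  apply (expect_scal _ _ H1 c (fun x => f (x + y))); now apply Hin.
- intros f Hf Hpos; apply (expect_pos _ _ H2); [now apply Hout | intros y].
  apply (expect_pos _ _ H1); [now apply Hin | auto].
- rewrite (expect_const H1); apply (expect_one _ _ H2).
- intros T F f C HF Hb Hlim.
  apply (expect_dct _ _ H2 T F (fun t y => E1 (fun x => f t (x + y))) (C * E1 (weight g)));
    [assumption | |].
  + intros t; apply (dominated_inner g C E1 (fun x y => f t (x + y))); trivial.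
    now apply dominated_shift.
  + intros y; apply (expect_dct _ _ H1 T F (fun t x => f t (x + y)) (C * weight g y));
      [assumption | | auto].
    intros t x; pose proof (dominated_shift g C (f t) (Hb t) x y); lra.
Qed.

Lemma fubini_convolve (g : R) (E1 E2 : (R -> R) -> R) :
  expectation g E1 -> expectation g E2 -> fubini g E1 -> fubini g E2 ->
  fubini g (convolve E1 E2).
Proof.
intros H1 H2 F1 F2 E' H' f C Hf; unfold convolve.
assert (Hxy : forall x y z, Rabs (f (x + y) z) <= C * (weight g x * weight g y) * weight g z).
{ intros x y z; pose proof (weight_ge_1 g z).
  replace (C * (weight g x * weight g y) * weight g z)
    with (C * weight g z * (weight g x * weight g y)) by ring.
  apply (dominated_shift g (C * weight g z) (fun x => f x z)).
  intros u; specialize (Hf u z); lra. }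
transitivity (E2 (fun y => E' (fun z => E1 (fun x => f (x + y) z)))).
- f_equal; apply functional_extensionality; intros y.
  apply (F1 E' H' (fun x z => f (x + y) z) (C * weight g y)).
  intros x z; specialize (Hxy x y z); lra.
- apply (F2 E' H' (fun y z => E1 (fun x => f (x + y) z)) (C * E1 (weight g))).
  intros y z.
  replace (C * E1 (weight g) * (weight g y * weight g z))
    with (C * weight g z * E1 (weight g) * weight g y) by ring.
  apply (dominated_inner g (C * weight g z) E1 (fun x y => f (x + y) z)); trivial.
  intros u v; specialize (Hxy u v z); lra.
Qed.

(** * Atomic expectations: dominated convergence and Fubini for series *)

Section Atomic.
Context {g : R} {w z : nat -> R}.
Context (w_nonneg : forall n, 0 <= w n) (w_sum : is_series w 1)
  (w_moment : ex_series (fun n => w n * exp (g * z n))).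

Lemma ex_series_atomic_abs (f : R -> R) : dominated g f ->
  ex_series (fun n => Rabs (w n * f (z n))).
Proof.
intros [C HC].
apply @ex_series_le with (fun n => C * (w n + w n * exp (g * z n))).
- intros n; unfold norm; simpl; unfold abs; simpl; rewrite Rabs_Rabsolu.
  rewrite Rabs_mult, (Rabs_pos_eq (w n)) by auto.
  specialize (HC (z n)); unfold weight in HC; specialize (w_nonneg n); nra.
- apply (ex_series_scal_l (V := R_NormedModule) C (fun n => w n + w n * exp (g * z n))).
  apply (ex_series_plus (V := R_NormedModule)); [now exists 1 | assumption].
Qed.

Lemma ex_series_atomic (f : R -> R) : dominated g f -> ex_series (fun n => w n * f (z n)).
Proof. intros; now apply ex_series_Rabs, ex_series_atomic_abs. Qed.

(** The remainder bound depends on [f] only through [C]. This uniformity drives both dominated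
    convergence and Fubini below. *)
Lemma atomic_remainder (f : R -> R) (C : R) (N : nat) :
  (forall x, Rabs (f x) <= C * weight g x) -> (0 < N)%nat ->
  Rabs (atomic w z f - sum_f_R0 (fun n => w n * f (z n)) (pred N))
    <= C * (atomic w z (weight g) - sum_f_R0 (fun n => w n * weight g (z n)) (pred N)).
Proof.
intros Hf HN; unfold atomic.
assert (Hd : dominated g f) by now exists C.
pose proof (ex_series_atomic (weight g) (dominated_weight g)) as Hw.
rewrite (Series_incr_n (fun n => w n * f (z n)) N HN) by now apply ex_series_atomic.
rewrite (Series_incr_n (fun n => w n * weight g (z n)) N HN Hw).
rewrite Rplus_minus_l, Rplus_minus_l, <- Series_scal_l.
eapply Rle_trans; [apply Series_Rabs |].
- apply (ex_series_incr_n (V := R_NormedModule) (fun n => Rabs (w n * f (z n))) N).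
  now apply ex_series_atomic_abs.
- apply Series_le.
  + intros n; split; [apply Rabs_pos |].
    rewrite Rabs_mult, (Rabs_pos_eq (w _)) by auto.
    specialize (Hf (z (N + n)%nat)); specialize (w_nonneg (N + n)%nat); nra.
  + apply (ex_series_scal_l (V := R_NormedModule) C (fun n => w (N + n)%nat * weight g (z (N + n)%nat))).
    apply (ex_series_incr_n (V := R_NormedModule) (fun n => w n * weight g (z n)) N).
    exact Hw.
Qed.

Lemma atomic_weight_remainder_small (eps : R) : 0 < eps ->
  exists N0, forall N, (N0 <= N)%nat ->
    atomic w z (weight g) - sum_f_R0 (fun n => w n * weight g (z n)) (pred N) < eps.
Proof.
intros Heps.
pose proof (Series_correct _ (ex_series_atomic (weight g) (dominated_weight g))) as H.
apply is_series_Reals in H; destruct (H eps Heps) as [N0 HN0].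
exists (S N0); intros N HN; specialize (HN0 (pred N)).
rewrite Rdist_sym in HN0; unfold Rdist in HN0; fold (atomic w z (weight g)) in HN0.
eapply Rle_lt_trans; [apply Rle_abs | apply HN0; lia].
Qed.

(** Dominated convergence holds along an arbitrary filter: the remainder past [N0] is small
    uniformly in the parameter, and only finitely many atoms are left, where pointwise convergence
    suffices. For a diffuse measure a general filter would not be allowed. *)
Lemma expectation_atomic : expectation g (atomic w z).
Proof.
split.
- intros f h Hf Hh; unfold atomic.
  rewrite <- Series_plus by now apply ex_series_atomic.
  apply Series_ext; intros; ring.
- intros c f Hf; unfold atomic.
  rewrite <- Series_scal_l; apply Series_ext; intros; ring.
- intros f Hf Hpos; unfold atomic.
  rewrite <- (Rmult_0_l (Series (fun n => w n * f (z n)))), <- Series_scal_l.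
  apply Series_le; [intros n | now apply ex_series_atomic].
  specialize (w_nonneg n); specialize (Hpos (z n)); nra.
- unfold atomic; rewrite (Series_ext _ w) by (intros; ring); now apply is_series_unique.
- intros T F f C HF Hb Hlim eps Heps.
  destruct (atomic_weight_remainder_small (eps / 2 / (Rabs C + 1))) as [N0 HN0].
  { pose proof (Rabs_pos C); apply Rdiv_lt_0_compat; lra. }
  assert (Hsum : F (fun t => Rabs (sum_f_R0 (fun n => w n * f t (z n)) N0) < eps / 2)).
  { assert (He : 0 < eps / 2) by lra; revert He; generalize (eps / 2); clear -HF Hlim w_nonneg.
    assert (Hone : forall n e, 0 < e -> F (fun t => Rabs (w n * f t (z n)) < e)).
    { intros n e He; specialize (w_nonneg n).
      generalize (Hlim (z n) (e / (w n + 1)) ltac:(apply Rdiv_lt_0_compat; lra)).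
      apply filter_imp; intros t Ht; rewrite Rabs_mult, Rabs_pos_eq by assumption.
      apply Rlt_div_r in Ht; [| lra].
      pose proof (Rabs_pos (f t (z n))); nra. }
    induction N0 as [|n IH]; intros e He; simpl; [now apply Hone |].
    assert (He2 : 0 < e / 2) by lra.
    generalize (filter_and _ _ (IH (e / 2) He2) (Hone (S n) (e / 2) He2)).
    apply filter_imp; intros t [Ha Hb].
    eapply Rle_lt_trans; [apply Rabs_triang | lra]. }
  revert Hsum; apply filter_imp; intros t Ht.
  pose proof (atomic_remainder (f t) C (S N0) (Hb t) (Nat.lt_0_succ _)) as Hr.
  specialize (HN0 (S N0) (le_S _ _ (le_n _))).
  cbn [pred] in *.
  set (q := atomic w z (weight g) - _) in *.
  assert (Hq : C * q < eps / 2).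
  { pose proof (Rabs_pos C); pose proof (Rle_abs C).
    apply Rlt_div_r in HN0; [| lra].
    destruct (Rle_lt_dec 0 q); [nra |].
    assert (0 <= C); [| nra].
    specialize (Hb t 0); pose proof (Rabs_pos (f t 0)); pose proof (weight_ge_1 g 0).
    apply Rmult_le_reg_r with (weight g 0); lra. }
  apply Rabs_def2 in Ht; apply Rabs_le_between in Hr; apply Rabs_def1; lra.
Qed.

(** Partial sums commute with [E'] by linearity. The remainders [r n] are dominated and tend to [0]
    pointwise, so dominated convergence for [E'] gives the limit. *)
Lemma fubini_atomic : fubini g (atomic w z).
Proof.
intros E' H' f C Hf.
assert (Hx : forall x y, Rabs (f x y) <= C * weight g x * weight g y)
  by (intros x y; specialize (Hf x y); lra).
assert (Hz : forall x, dominated g (f x)) by (intros x; exists (C * weight g x); apply Hx).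
assert (Hfin : forall n, dominated g (fun y => sum_f_R0 (fun n => w n * f (z n) y) n) /\
   E' (fun y => sum_f_R0 (fun n => w n * f (z n) y) n) = sum_f_R0 (fun n => w n * E' (f (z n))) n).
{ induction n as [|n [IH1 IH2]]; simpl.
  - split; [now apply dominated_scal | now apply (expect_scal _ _ H')].
  - split; [apply dominated_plus; [assumption | now apply dominated_scal] |].
    rewrite (expect_plus _ _ H'), IH2, (expect_scal _ _ H'); auto using dominated_scal. }
assert (HE : expectation g (atomic w z)) by apply expectation_atomic.
assert (Hout : forall y, Rabs (atomic w z (fun x => f x y)) <= C * atomic w z (weight g) * weight g y)
  by (apply (dominated_inner g C (atomic w z) f); trivial).
assert (HC : 0 <= C).
{ specialize (Hf 0 0); pose proof (Rabs_pos (f 0 0)); pose proof (weight_ge_1 g 0).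
  apply Rmult_le_reg_r with (weight g 0 * weight g 0); nra. }
unfold atomic at 1; apply is_series_unique, is_series_Reals.
intros eps Heps.
pose (r := fun (n : nat) (y : R) =>
  atomic w z (fun x => f x y) - sum_f_R0 (fun k => w k * f (z k) y) n).
assert (Hr : forall n y, Rabs (r n y) <= C * weight g y *
   (atomic w z (weight g) - sum_f_R0 (fun k => w k * weight g (z k)) n)).
{ intros n y; apply (atomic_remainder (fun x => f x y) (C * weight g y) (S n)); [| lia].
  intros x; specialize (Hx x y); lra. }
assert (Hlim : eventually (fun n => Rabs (E' (r n)) < eps)).
{ refine (expect_dct _ _ H' nat eventually r (C * atomic w z (weight g)) _ _ _ eps Heps).
  - intros n y; eapply Rle_trans; [apply Hr |].
    assert (0 <= sum_f_R0 (fun k => w k * weight g (z k)) n).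
    { apply cond_pos_sum; intros k; pose proof (weight_ge_1 g (z k)).
      specialize (w_nonneg k); nra. }
    pose proof (weight_ge_1 g y).
    assert (0 <= C * weight g y) by nra; nra.
  - intros y e He.
    pose proof (weight_ge_1 g y).
    destruct (atomic_weight_remainder_small (e / (C * weight g y + 1))) as [N0 HN0].
    { apply Rdiv_lt_0_compat; nra. }
    exists N0; intros n Hn.
    eapply Rle_lt_trans; [apply Hr |].
    specialize (HN0 (S n) ltac:(lia)); cbn [pred] in HN0.
    assert (0 <= C * weight g y) by nra.
    apply Rlt_div_r in HN0; [| nra].
    set (q := atomic w z (weight g) - _) in *.
    destruct (Rle_lt_dec 0 q); nra. }
destruct Hlim as [N HN]; exists N; intros n Hn; specialize (HN n Hn).
unfold r in HN; rewrite (expect_minus H'), (proj2 (Hfin n)) in HN.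
- rewrite Rdist_sym; exact HN.
- exists (C * atomic w z (weight g)); apply Hout.
- apply Hfin.
Qed.

End Atomic.

(** * Distributions from expectation functionals *)

Lemma dominated_exp (g : R) : dominated g (fun y => exp (g * y)).
Proof.
exists 1; intros y; rewrite Rabs_pos_eq by (left; apply exp_pos).
rewrite Rmult_1_l; apply exp_le_weight.
Qed.

Lemma sum_ind_disjoint (A : nat -> R -> Prop) (x : R) (n : nat) :
  (forall n m x, A n x -> A m x -> n = m) ->
  sum_f_R0 (fun k => ind (A k x)) n = ind (exists k, (k <= n)%nat /\ A k x).
Proof.
intros Hdis; induction n as [|n IH]; simpl.
- apply ind_iff; split.
  + intros H; now exists 0%nat.
  + intros [k [Hk H]]; replace k with 0%nat in H by lia; exact H.
- rewrite IH; destruct (excluded_middle_informative (A (S n) x)) as [H|H].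
  + rewrite (ind_true (A (S n) x)), ind_false, ind_true; trivial; [ring | now exists (S n) |].
    intros [k [Hk Hkx]]; specialize (Hdis _ _ _ H Hkx); lia.
  + rewrite (ind_false (A (S n) x)), Rplus_0_r by assumption.
    apply ind_iff; split; intros [k [Hk Hkx]].
    * exists k; split; [lia | assumption].
    * destruct (Nat.eq_dec k (S n)) as [->|]; [tauto |].
      exists k; split; [lia | assumption].
Qed.

(** Countable additivity is dominated convergence for the difference between the indicators of the
    finite unions and of the full union. *)
Lemma expect_sigma (g : R) (E : (R -> R) -> R) (A : nat -> R -> Prop) :
  expectation g E -> (forall n m x, A n x -> A m x -> n = m) ->
  infinite_sum (fun n => E (fun x => ind (A n x))) (E (fun x => ind (exists n, A n x))).
Proof.
intros HE Hdis eps Heps.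
pose (r := fun (n : nat) (x : R) =>
  ind (exists k, (k <= n)%nat /\ A k x) - ind (exists k, A k x)).
assert (Hsum : forall n, sum_f_R0 (fun k => E (fun x => ind (A k x))) n =
  E (fun x => ind (exists k, (k <= n)%nat /\ A k x))).
{ intros n.
  replace (fun x => ind (exists k, (k <= n)%nat /\ A k x))
    with (fun x => sum_f_R0 (fun k => ind (A k x)) n)
    by (apply functional_extensionality; intros x; now apply sum_ind_disjoint).
  assert (Hfin : dominated g (fun x => sum_f_R0 (fun k => ind (A k x)) n) /\
    sum_f_R0 (fun k => E (fun x => ind (A k x))) n =
    E (fun x => sum_f_R0 (fun k => ind (A k x)) n)); [| apply Hfin].
  induction n as [|n [IH1 IH2]]; simpl.
  - split; [apply dominated_ind | reflexivity].
  - split; [apply dominated_plus; [assumption | apply dominated_ind] |].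
    rewrite (expect_plus _ _ HE), IH2; auto using dominated_ind. }
assert (Hlim : eventually (fun n => Rabs (E (r n)) < eps)).
{ refine (expect_dct _ _ HE nat eventually r 1 _ _ _ eps Heps).
  - intros n x; unfold r; pose proof (weight_ge_1 g x).
    pose proof (ind_bounds (exists k, (k <= n)%nat /\ A k x)).
    pose proof (ind_bounds (exists k, A k x)).
    apply Rabs_le; lra.
  - intros x e He; unfold r.
    destruct (excluded_middle_informative (exists k, A k x)) as [[k Hk]|H].
    + exists k; intros n Hn; rewrite !ind_true; [| now exists k | now exists k].
      rewrite Rminus_diag, Rabs_R0; assumption.
    + exists 0%nat; intros n _; rewrite !ind_false; trivial.
      * rewrite Rminus_diag, Rabs_R0; assumption.
      * intros [k [_ Hk]]; apply H; now exists k. }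
destruct Hlim as [N HN]; exists N; intros n Hn; specialize (HN n Hn).
unfold r in HN; rewrite (expect_minus HE) in HN by apply dominated_ind.
unfold Rdist; rewrite Hsum; exact HN.
Qed.

(** Closed with [Defined] so that the tail of this distribution converts to [survival E] by
    computation. *)
Definition distr_of {g : R} {E : (R -> R) -> R} (HE : expectation g E) : distr.
Proof.
refine {| pm := fun A => E (fun x => ind (A x)) |}.
- intros A B HAB; f_equal; apply functional_extensionality; intros x; now apply ind_iff.
- intros A _; apply (expect_pos _ _ HE); [apply dominated_ind | intros x; apply ind_bounds].
- rewrite <- (expect_one _ _ HE); f_equal; apply functional_extensionality; intros x.
  now apply ind_true.
- intros A _ Hdis; now apply expect_sigma with g.
Defined.

(** The map [t -> E (Rmin t f)] is an antiderivative of [t -> E (ind (t < f))]: between [s] and [t]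
    the function [Rmin] grows by at least [t - s] where [t < f] and by at most [t - s] where
    [s < f]. Its supremum over [t] is [E f], by dominated convergence. *)
Lemma integral_is_expect {g : R} {E : (R -> R) -> R} (HE : expectation g E) (f : R -> R) :
  (forall x, 0 <= f x) -> dominated g f -> integral_is (distr_of HE) f (E f).
Proof.
intros Hpos Hf; unfold integral_is; simpl.
pose (phi := fun t => E (fun x => ind (t < f x))).
pose (G := fun t => E (fun x => Rmin t (f x))).
assert (Hmin : forall t, dominated g (fun x => Rmin t (f x))).
{ intros t; destruct Hf as [C HC]; exists (Rabs t + C); intros x.
  pose proof (weight_ge_1 g x); specialize (HC x); pose proof (Rabs_pos t).
  apply Rle_trans with (Rabs t + Rabs (f x)); [| nra].
  pose proof (Rabs_pos (f x)); unfold Rmin; destruct (Rle_dec t (f x)); lra. }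
assert (Hdec : forall s t, s <= t -> phi t <= phi s).
{ intros s t Hst; apply (expect_le HE); try apply (dominated_ind g (fun x => _ < f x)).
  intros x; apply ind_le; lra. }
assert (Hb : forall t, 0 <= phi t <= 1).
{ intros t; rewrite <- (expect_one _ _ HE) at 1; split.
  - apply (expect_pos _ _ HE); [apply (dominated_ind g (fun x => t < f x)) |].
    intros; apply ind_bounds.
  - apply (expect_le HE); [apply (dominated_ind g (fun x => t < f x)) | |].
    + apply dominated_const.
    + intros; apply ind_bounds. }
assert (HG : forall s t, s <= t -> (t - s) * phi t <= G t - G s <= (t - s) * phi s).
{ intros s t Hst; unfold phi, G.
  rewrite <- (expect_minus HE) by trivial.
  rewrite <- !(expect_scal _ _ HE) by apply (dominated_ind g (fun x => _ < f x)).
  split; apply (expect_le HE);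
    try (apply dominated_scal, (dominated_ind g (fun x => _ < f x)));
    try (now apply dominated_minus); intros x;
    unfold Rmin; destruct (Rle_dec t (f x)); destruct (Rle_dec s (f x));
    match goal with |- context [ind (?a < ?b)] =>
      destruct (Rlt_le_dec a b); [rewrite ind_true by lra | rewrite ind_false by lra] end;
    lra. }
assert (HG0 : G 0 = 0).
{ rewrite <- (expect_const HE 0) at 2; unfold G; f_equal.
  apply functional_extensionality; intros x; now apply Rmin_left. }
assert (HRI : forall T, 0 <= T -> RInt phi 0 T = G T).
{ intros T HT; rewrite (RInt_antitone_sandwich phi G T Hdec Hb HT HG), HG0; apply Rminus_0_r. }
split.
- intros v (T & pr & HT & ->).
  rewrite <- (RInt_Reals _ _ _ pr); fold phi; rewrite HRI by assumption.
  apply (expect_le HE); trivial; intros x; apply Rmin_r.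
- intros b Hub; apply le_epsilon; intros eps Heps.
  destruct Hf as [C HC].
  assert (Hlim : eventually (fun n => Rabs (E (fun x => f x - Rmin (INR n) (f x))) < eps)).
  { refine (expect_dct _ _ HE nat eventually (fun n x => f x - Rmin (INR n) (f x)) C _ _ _ eps Heps).
    - intros n x; eapply Rle_trans, HC; specialize (Hpos x); pose proof (pos_INR n).
      unfold Rmin; destruct (Rle_dec (INR n) (f x)); rewrite !Rabs_pos_eq; lra.
    - intros x e He; destruct (nfloor_ex (f x) (Hpos x)) as [N HN].
      exists (S N); intros n Hn; apply le_INR in Hn; rewrite S_INR in Hn.
      rewrite Rmin_right, Rminus_diag, Rabs_R0; lra. }
  destruct Hlim as [N HN]; specialize (HN N (le_n N)).
  rewrite (expect_minus HE) in HN; [| now exists C | trivial].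
  fold (G (INR N)) in HN; apply Rabs_def2 in HN.
  assert (G (INR N) <= b); [| lra].
  apply Hub; exists (INR N).
  exists (ex_RInt_Reals_0 phi 0 (INR N) (ex_RInt_antitone phi (INR N) Hdec Hb (pos_INR N))).
  split; [apply pos_INR |].
  rewrite <- RInt_Reals, HRI; trivial; apply pos_INR.
Qed.

Lemma is_conv_distr_of {g : R} {E1 E2 : (R -> R) -> R}
  (H1 : expectation g E1) (H2 : expectation g E2) :
  is_conv (distr_of H1) (distr_of H2) (distr_of (expectation_convolve g E1 E2 H1 H2)).
Proof.
intros A _.
apply (integral_is_expect H2 (fun y => E1 (fun x => ind (A (x + y))))).
- intros y; apply (expect_pos _ _ H1); [| intros; apply ind_bounds].
  apply (dominated_ind g (fun x => A (x + y))).
- apply dominated_bounded with 1; intros y.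
  rewrite <- (expect_const H1 1).
  apply (expect_abs_le H1); [apply dominated_const | intros x].
  pose proof (ind_bounds (A (x + y))); rewrite Rabs_pos_eq; lra.
Qed.

Lemma laplace_is_distr_of {g : R} {E : (R -> R) -> R} (HE : expectation g E) :
  laplace_is (distr_of HE) g (E (fun y => exp (g * y))).
Proof.
apply integral_is_expect; [intros; left; apply exp_pos | apply dominated_exp].
Qed.

(** Multiplying [f t] by the indicator of the good parameters turns eventual domination into
    domination for all parameters. *)
Lemma expect_dct_eventually {g : R} {E : (R -> R) -> R} (HE : expectation g E)
  (T : Type) (F : (T -> Prop) -> Prop) (f : T -> R -> R) (C : R) :
  Filter F -> F (fun t => forall x, Rabs (f t x) <= C * weight g x) ->
  (forall x eps, 0 < eps -> F (fun t => Rabs (f t x) < eps)) ->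
  forall eps, 0 < eps -> F (fun t => Rabs (E (f t)) < eps).
Proof.
intros HF Hb Hlim eps Heps.
pose (D := fun t => forall x, Rabs (f t x) <= C * weight g x).
assert (H : F (fun t => Rabs (E (fun x => ind (D t) * f t x)) < eps)).
{ apply (expect_dct _ _ HE T F (fun t x => ind (D t) * f t x) (Rabs C)); trivial.
  - intros t x; pose proof (weight_ge_1 g x); pose proof (Rabs_pos C); pose proof (Rle_abs C).
    destruct (excluded_middle_informative (D t)) as [Hd|Hd].
    + rewrite (ind_true _ Hd), Rmult_1_l; specialize (Hd x); nra.
    + rewrite (ind_false _ Hd), Rmult_0_l, Rabs_R0; nra.
  - intros x e He; generalize (Hlim x e He); apply filter_imp; intros t Ht.
    pose proof (ind_bounds (D t)); rewrite Rabs_mult, Rabs_pos_eq by lra.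
    pose proof (Rabs_pos (f t x)); nra. }
generalize (filter_and _ _ H Hb); apply filter_imp; intros t [Ht Hd].
rewrite (ind_true (D t) Hd) in Ht.
replace (f t) with (fun x => 1 * f t x)
  by (apply functional_extensionality; intros; ring); assumption.
Qed.

(** * Tails of convolutions *)

Definition vanishes (u : R -> R) : Prop :=
  forall eps, 0 < eps -> Rbar_locally p_infty (fun x => Rabs (u x) < eps).

Lemma vanishes_plus (u v : R -> R) : vanishes u -> vanishes v -> vanishes (fun x => u x + v x).
Proof.
intros Hu Hv eps Heps.
assert (He : 0 < eps / 2) by lra.
generalize (filter_and _ _ (Hu _ He) (Hv _ He)); apply filter_imp; intros x [H1 H2].
eapply Rle_lt_trans; [apply Rabs_triang | lra].
Qed.

Lemma vanishes_le (u v : R -> R) : vanishes v ->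
  Rbar_locally p_infty (fun x => Rabs (u x) <= v x) -> vanishes u.
Proof.
intros Hv Huv eps Heps; generalize (filter_and _ _ (Hv eps Heps) Huv).
apply filter_imp; intros x [H1 H2]; pose proof (Rle_abs (v x)); lra.
Qed.

Lemma vanishes_inv (c : R) : vanishes (fun x => c / x).
Proof.
intros eps Heps; exists (Rabs c / eps); intros x Hx.
assert (0 <= Rabs c / eps)
  by (apply Rmult_le_pos; [apply Rabs_pos | left; now apply Rinv_0_lt_compat]).
unfold Rdiv; rewrite Rabs_mult, (Rabs_pos_eq (/ x)) by (left; apply Rinv_0_lt_compat; lra).
apply Rlt_div_l; [lra |]; apply Rlt_div_l in Hx; lra.
Qed.

Lemma vanishes_scal_abs (c : R) (u : R -> R) : 0 <= c -> vanishes u ->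
  vanishes (fun x => c * Rabs (u x)).
Proof.
intros Hc Hu eps Heps.
generalize (Hu (eps / (c + 1)) (Rdiv_lt_0_compat _ _ Heps (Rle_lt_0_plus_1 _ Hc))).
apply filter_imp; intros x Hx; rewrite Rabs_mult, Rabs_Rabsolu, Rabs_pos_eq by lra.
apply Rlt_div_r in Hx; [| lra]; pose proof (Rabs_pos (u x)); nra.
Qed.

Definition survival (E : (R -> R) -> R) (x : R) : R := E (fun y => ind (x < y)).

(** The normalisation under which tails of order [exp (- g x) / (1 + x)^2] stay bounded; [profile]
    then records their limiting shape, which may oscillate. *)
Definition rescaled (g : R) (E : (R -> R) -> R) (x : R) : R :=
  exp (g * x) * (1 + x) ^ 2 * survival E x.

Definition profile (g : R) (E : (R -> R) -> R) (p : R -> R) : Prop :=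
  vanishes (fun x => rescaled g E x - p x).

Lemma survival_bounds {g : R} {E : (R -> R) -> R} (HE : expectation g E) (x : R) :
  0 <= survival E x <= 1.
Proof.
unfold survival; split.
- apply (expect_pos _ _ HE); [apply (dominated_ind g (fun y => x < y)) |].
  intros; apply ind_bounds.
- rewrite <- (expect_one _ _ HE); apply (expect_le HE).
  + apply (dominated_ind g (fun y => x < y)).
  + apply dominated_const.
  + intros; apply ind_bounds.
Qed.

Lemma survival_antitone {g : R} {E : (R -> R) -> R} (HE : expectation g E) (x y : R) :
  x <= y -> survival E y <= survival E x.
Proof.
intros Hxy; apply (expect_le HE); try apply (dominated_ind g (fun z => _ < z)).
intros z; apply ind_le; lra.
Qed.

(** Far out the profile gives the bound [P + 1]; on the remaining bounded range [survival E x <= 1]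
    is enough. *)
Lemma rescaled_bounded {g P : R} {E : (R -> R) -> R} {p : R -> R} :
  0 < g -> expectation g E -> (forall x, Rabs (p x) <= P) -> profile g E p ->
  exists K, forall x, 0 <= x -> 0 <= rescaled g E x <= K.
Proof.
intros Hg HE Hp Hprof; destruct (Hprof 1 Rlt_0_1) as [M HM].
exists (P + 1 + exp (g * Rabs M) * (1 + Rabs M) ^ 2); intros x Hx.
pose proof (survival_bounds HE x) as Hs.
assert (Hpos : 0 <= exp (g * x) * (1 + x) ^ 2)
  by (apply Rmult_le_pos; [left; apply exp_pos | apply pow2_ge_0]).
assert (HM0 : 0 <= exp (g * Rabs M) * (1 + Rabs M) ^ 2)
  by (apply Rmult_le_pos; [left; apply exp_pos | apply pow2_ge_0]).
assert (HP : 0 <= P) by (eapply Rle_trans, (Hp 0); apply Rabs_pos).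
split; [apply Rmult_le_pos; lra |].
destruct (Rle_lt_dec x M) as [HxM|HxM].
- apply Rle_trans with (exp (g * Rabs M) * (1 + Rabs M) ^ 2); [| lra].
  unfold rescaled; apply Rle_trans with (exp (g * x) * (1 + x) ^ 2 * 1);
    [apply Rmult_le_compat_l; lra | rewrite Rmult_1_r].
  pose proof (Rle_abs M).
  apply Rmult_le_compat; [left; apply exp_pos | apply pow2_ge_0 | | apply pow_incr; lra].
  apply exp_le_compat, Rmult_le_compat_l; lra.
- specialize (HM x HxM); specialize (Hp x).
  apply Rabs_def2 in HM; apply Rabs_le_between in Hp; lra.
Qed.

Lemma rescaled_shift (g : R) (E : (R -> R) -> R) (x y : R) : 1 + x - y <> 0 ->
  exp (g * x) * (1 + x) ^ 2 * survival E (x - y) =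
  exp (g * y) * (((1 + x) / (1 + x - y)) ^ 2 * rescaled g E (x - y)).
Proof.
intros H; unfold rescaled.
replace (g * x) with (g * y + g * (x - y)) by ring; rewrite exp_plus.
replace (1 + (x - y)) with (1 + x - y) by ring; field; assumption.
Qed.

Lemma shift_ratio_vanishes (y : R) : vanishes (fun x => ((1 + x) / (1 + x - y)) ^ 2 - 1).
Proof.
apply vanishes_le with (fun x => 6 * Rabs y / x); [apply vanishes_inv |].
exists (2 * Rabs y + 1); intros x Hx.
pose proof (Rle_abs y); pose proof (Rle_abs (- y)) as Hy; rewrite Rabs_Ropp in Hy.
pose proof (Rabs_pos y).
(* With [q = y / (1 + x - y)] the ratio is [1 + q], so its square minus [1] is [q * (2 + q)], where
   [|q| <= 2 |y| / x <= 1]. *)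
assert (Hs : Rabs (y / (1 + x - y)) <= 2 * Rabs y / x).
{ assert (Hi : 0 <= / (1 + x - y)) by (left; apply Rinv_0_lt_compat; lra).
  unfold Rdiv at 1; rewrite Rabs_mult, (Rabs_pos_eq (/ _) Hi).
  apply -> Rle_div_r; [| lra].
  replace (Rabs y * / (1 + x - y) * x) with (Rabs y * x / (1 + x - y)) by (unfold Rdiv; ring).
  apply <- Rle_div_l; [| lra].
  replace (2 * Rabs y * (1 + x - y)) with (Rabs y * (2 * (1 + x - y))) by ring.
  apply Rmult_le_compat_l; lra. }
assert (H1 : 2 * Rabs y / x <= 1) by (apply Rle_div_l; [lra | rewrite Rmult_1_l; lra]).
replace (((1 + x) / (1 + x - y)) ^ 2 - 1)
  with (y / (1 + x - y) * (2 + y / (1 + x - y))) by (field; lra).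
rewrite Rabs_mult.
assert (Rabs (2 + y / (1 + x - y)) <= 3).
{ eapply Rle_trans; [apply Rabs_triang |]; rewrite (Rabs_pos_eq 2); lra. }
pose proof (Rabs_pos (y / (1 + x - y))).
replace (6 * Rabs y / x) with (2 * Rabs y / x * 3) by (field; lra).
apply Rmult_le_compat; try apply Rabs_pos; assumption.
Qed.

Lemma profile_shift {g P : R} {E : (R -> R) -> R} {p : R -> R} (y : R) :
  0 < g -> expectation g E -> (forall x, Rabs (p x) <= P) -> profile g E p ->
  vanishes (fun x => ((1 + x) / (1 + x - y)) ^ 2 * rescaled g E (x - y) - p (x - y)).
Proof.
intros Hg HE Hp Hprof.
destruct (rescaled_bounded Hg HE Hp Hprof) as [K HK].
assert (HK0 : 0 <= K) by (specialize (HK 0 (Rle_refl 0)); lra).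
apply vanishes_le with (fun x => K * Rabs (((1 + x) / (1 + x - y)) ^ 2 - 1)
                 + Rabs (rescaled g E (x - y) - p (x - y))).
- apply vanishes_plus.
  + apply vanishes_scal_abs; [assumption | apply shift_ratio_vanishes].
  + intros eps Heps; destruct (Hprof eps Heps) as [M HM].
    exists (M + y); intros x Hx; rewrite Rabs_Rabsolu; apply HM; lra.
- exists y; intros x Hx; set (r := ((1 + x) / (1 + x - y)) ^ 2).
  replace (r * rescaled g E (x - y) - p (x - y))
    with (rescaled g E (x - y) * (r - 1) + (rescaled g E (x - y) - p (x - y))) by ring.
  eapply Rle_trans; [apply Rabs_triang |]; apply Rplus_le_compat_r.
  specialize (HK (x - y)); rewrite Rabs_mult, (Rabs_pos_eq (rescaled _ _ _)) by lra.
  apply Rmult_le_compat_r; [apply Rabs_pos | lra].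
Qed.

(** Dominated convergence in [y] as [x] grows. For fixed [y] the constraint [y <= x / 2] eventually
    holds and [profile_shift] gives the limit; the cut at [x / 2] is what provides an integrable
    bound. *)
Lemma half_convolution_profile {g P : R} {E1 E2 : (R -> R) -> R} {p : R -> R} :
  0 < g -> expectation g E1 -> expectation g E2 ->
  (forall x, Rabs (p x) <= P) -> profile g E1 p ->
  vanishes (fun x =>
    exp (g * x) * (1 + x) ^ 2 * E2 (fun y => ind (y <= x / 2) * survival E1 (x - y))
    - E2 (fun y => exp (g * y) * p (x - y))).
Proof.
intros Hg H1 H2 Hp Hprof.
destruct (rescaled_bounded Hg H1 Hp Hprof) as [K HK].
pose (f := fun x y => exp (g * x) * (1 + x) ^ 2 * (ind (y <= x / 2) * survival E1 (x - y))
   - exp (g * y) * p (x - y)).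
assert (HP : 0 <= P) by (eapply Rle_trans, (Hp 0); apply Rabs_pos).
assert (HK0 : 0 <= K) by (specialize (HK 0 (Rle_refl 0)); lra).
assert (Hdom : forall x, dominated g (fun y => ind (y <= x / 2) * survival E1 (x - y))).
{ intros x; apply dominated_bounded with 1; intros y.
  pose proof (survival_bounds H1 (x - y)); pose proof (ind_bounds (y <= x / 2)).
  rewrite Rabs_pos_eq; nra. }
intros eps Heps.
assert (Hlim : Rbar_locally p_infty (fun x => Rabs (E2 (f x)) < eps)).
{ apply (expect_dct_eventually H2 R (Rbar_locally p_infty) f (4 * K + P)); trivial.
  - apply Rbar_locally_filter.
  - exists 0; intros x Hx y; unfold f; specialize (Hp (x - y)).
    pose proof (exp_pos (g * y)); pose proof (exp_le_weight g y).
    apply Rle_trans with (exp (g * y) * (4 * K + P)); [| nra].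
    destruct (Rle_lt_dec y (x / 2)) as [Hy|Hy].
    + rewrite ind_true, Rmult_1_l, rescaled_shift by lra.
      rewrite <- Rmult_minus_distr_l, Rabs_mult, (Rabs_pos_eq (exp _)) by lra.
      apply Rmult_le_compat_l; [lra |].
      eapply Rle_trans; [apply Rabs_triang |]; rewrite Rabs_Ropp.
      apply Rplus_le_compat; [| exact Hp].
      assert (Hr : 0 <= (1 + x) / (1 + x - y) <= 2).
      { split; [apply Rmult_le_pos; [lra | left; apply Rinv_0_lt_compat; lra] |].
        apply Rle_div_l; lra. }
      specialize (HK (x - y)).
      rewrite Rabs_mult, !Rabs_pos_eq; [| lra | apply pow2_ge_0].
      apply Rmult_le_compat; [apply pow2_ge_0 | lra | nra | lra].
    + rewrite ind_false by lra.
      replace (_ - _) with (- (exp (g * y) * p (x - y))) by ring.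
      rewrite Rabs_Ropp, Rabs_mult, (Rabs_pos_eq (exp _)) by lra.
      apply Rmult_le_compat_l; lra.
  - intros y; pose proof (exp_pos (g * y)) as He.
    apply (vanishes_le _ _ (vanishes_scal_abs _ _ (Rlt_le _ _ He) (profile_shift y Hg H1 Hp Hprof))).
    exists (2 * Rabs y); intros x Hx.
    pose proof (Rle_abs y); pose proof (Rabs_pos y).
    unfold f; rewrite ind_true, Rmult_1_l, rescaled_shift by lra.
    rewrite <- Rmult_minus_distr_l, Rabs_mult, (Rabs_pos_eq (exp _)) by lra; right; reflexivity. }
revert Hlim; apply filter_imp; intros x Hx; unfold f in Hx.
rewrite (expect_minus H2), (expect_scal _ _ H2) in Hx; trivial.
- now apply dominated_scal.
- apply dominated_exp_mult with P; intros; apply Hp.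
Qed.

(** On [X + Y > x] either [Y <= x/2], or [X <= x/2], or both exceed [x/2]. *)
Lemma survival_convolve {g : R} {E1 E2 : (R -> R) -> R} (x : R) :
  expectation g E1 -> expectation g E2 -> fubini g E1 ->
  survival (convolve E1 E2) x =
    E2 (fun y => ind (y <= x / 2) * survival E1 (x - y))
    + E1 (fun a => ind (a <= x / 2) * survival E2 (x - a))
    + survival E1 (x / 2) * survival E2 (x / 2).
Proof.
intros H1 H2 F1.
assert (Hi : forall A, dominated g (fun a => ind (A a))) by (intros; apply dominated_ind).
assert (Hpt : forall a b, ind (x < a + b) = ind (b <= x / 2) * ind (x - b < a)
   + ind (a <= x / 2) * ind (x - a < b) + ind (x / 2 < b) * ind (x / 2 < a)).
{ intros a b.
  destruct (Rle_lt_dec a (x / 2)) as [Ha|Ha];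
  [rewrite (ind_true (a <= _)), (ind_false (x / 2 < a)) by lra
  |rewrite (ind_false (a <= _)), (ind_true (x / 2 < a)) by lra];
  (destruct (Rle_lt_dec b (x / 2)) as [Hb|Hb];
  [rewrite (ind_true (b <= _)), (ind_false (x / 2 < b)) by lra
  |rewrite (ind_false (b <= _)), (ind_true (x / 2 < b)) by lra]).
  - rewrite !ind_false by lra; ring.
  - rewrite (ind_iff (x < a + b) (x - a < b)) by (split; lra); ring.
  - rewrite (ind_iff (x < a + b) (x - b < a)) by (split; lra); ring.
  - rewrite ind_true by lra; ring. }
assert (Hprod : forall A B, 0 <= ind A * ind B <= 1).
{ intros A B; pose proof (ind_bounds A); pose proof (ind_bounds B); nra. }
assert (HA : forall E, expectation g E -> forall c, 
   dominated g (fun y => ind (y <= x / 2) * survival E (c y))).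
{ intros E HE c; apply dominated_bounded with 1; intros y.
  pose proof (survival_bounds HE (c y)); pose proof (ind_bounds (y <= x / 2)).
  rewrite Rabs_pos_eq; nra. }
assert (HB : forall b, dominated g (fun a => ind (a <= x / 2) * ind (x - a < b))).
{ intros b; apply dominated_bounded with 1; intros a.
  rewrite Rabs_pos_eq; apply Hprod. }
replace (survival E1 (x / 2) * survival E2 (x / 2))
  with (E2 (fun y => survival E1 (x / 2) * ind (x / 2 < y)))
  by apply (expect_scal _ _ H2), (Hi (fun y => x / 2 < y)).
(* In this term the variable of [E1] is the outer one, whereas [convolve] integrates it first;
   Fubini swaps the order. *)
replace (E1 (fun a => ind (a <= x / 2) * survival E2 (x - a)))
  with (E2 (fun y => E1 (fun a => ind (a <= x / 2) * ind (x - a < y)))).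
2: { rewrite <- (F1 E2 H2 (fun a y => ind (a <= x / 2) * ind (x - a < y)) 1).
  - f_equal; apply functional_extensionality; intros a.
    apply (expect_scal _ _ H2), (Hi (fun y => x - a < y)).
  - intros a y; specialize (Hprod (a <= x / 2) (x - a < y)); rewrite Rabs_pos_eq by lra.
    pose proof (weight_ge_1 g a); pose proof (weight_ge_1 g y); nra. }
assert (HC : dominated g (fun y => E1 (fun a => ind (a <= x / 2) * ind (x - a < y)))).
{ apply dominated_bounded with 1; intros y.
  rewrite <- (expect_const H1 1); apply (expect_abs_le H1); [apply dominated_const |].
  intros a; rewrite Rabs_pos_eq; apply Hprod. }
assert (HD : forall E b, dominated g (fun a => survival E b * ind (x / 2 < a)))
  by (intros; apply dominated_scal, Hi).
rewrite <- (expect_plus _ _ H2 _ _ (HA E1 H1 (fun y => x - y)) HC).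
rewrite <- (expect_plus _ _ H2 _ _ (dominated_plus _ _ _ (HA E1 H1 (fun y => x - y)) HC)
  (HD E1 (x / 2))).
unfold survival at 1, convolve; f_equal; apply functional_extensionality; intros y.
rewrite (Rmult_comm (survival E1 (x / 2))); unfold survival.
rewrite <- (expect_scal _ _ H1 _ (fun a => ind (x - y < a))) by apply Hi.
rewrite <- (expect_scal _ _ H1 _ (fun a => ind (x / 2 < a))) by apply Hi.
assert (HF : dominated g (fun a => ind (y <= x / 2) * ind (x - y < a)))
  by apply dominated_scal, (Hi (fun a => x - y < a)).
assert (HG : dominated g (fun a => ind (x / 2 < y) * ind (x / 2 < a)))
  by apply dominated_scal, (Hi (fun a => x / 2 < a)).
rewrite <- (expect_plus _ _ H1 _ _ HF (HB y)).
rewrite <- (expect_plus _ _ H1 _ _ (dominated_plus _ _ _ HF (HB y)) HG).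
f_equal; apply functional_extensionality; intros a; apply Hpt.
Qed.

(** The two half-convolutions contribute one summand each. When both variables exceed [x / 2] the
    rescaled contribution is at most [K1 * K2 * (1 + x)^2 / (1 + x / 2)^4], which is of order
    [1 / x] at most because [(1 + x)^2 <= 4 (1 + x / 2)^2] and [x <= (1 + x / 2)^2]. *)
Lemma profile_convolve {g P : R} {E1 E2 : (R -> R) -> R} {p1 p2 : R -> R} :
  0 < g -> expectation g E1 -> expectation g E2 -> fubini g E1 ->
  (forall x, Rabs (p1 x) <= P) -> (forall x, Rabs (p2 x) <= P) ->
  profile g E1 p1 -> profile g E2 p2 ->
  profile g (convolve E1 E2) (fun x =>
    E2 (fun y => exp (g * y) * p1 (x - y)) + E1 (fun y => exp (g * y) * p2 (x - y))).
Proof.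
intros Hg H1 H2 F1 Hp1 Hp2 Hprof1 Hprof2.
pose proof (half_convolution_profile Hg H1 H2 Hp1 Hprof1) as V1.
pose proof (half_convolution_profile Hg H2 H1 Hp2 Hprof2) as V2.
destruct (rescaled_bounded Hg H1 Hp1 Hprof1) as [K1 HK1].
destruct (rescaled_bounded Hg H2 Hp2 Hprof2) as [K2 HK2].
assert (V3 : vanishes (fun x =>
  exp (g * x) * (1 + x) ^ 2 * (survival E1 (x / 2) * survival E2 (x / 2)))).
{ apply vanishes_le with (fun x => 4 * (K1 * K2) / x); [apply vanishes_inv |].
  exists 1; intros x Hx.
  specialize (HK1 (x / 2)); specialize (HK2 (x / 2)).
  replace (exp (g * x) * (1 + x) ^ 2 * (survival E1 (x / 2) * survival E2 (x / 2)))
    with (rescaled g E1 (x / 2) * rescaled g E2 (x / 2) * ((1 + x) ^ 2 / (1 + x / 2) ^ 4)).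
  2: { unfold rescaled; replace (g * x) with (g * (x / 2) + g * (x / 2)) by field.
    rewrite exp_plus; field; lra. }
  assert (Hq : 0 <= (1 + x) ^ 2 / (1 + x / 2) ^ 4 <= 4 / x).
  { split; [apply Rmult_le_pos; [apply pow2_ge_0 | left; apply Rinv_0_lt_compat, pow_lt; lra] |].
    apply Rle_div_l; [apply pow_lt; lra |].
    replace (4 / x * (1 + x / 2) ^ 4) with (4 * (1 + x / 2) ^ 4 / x) by (field; lra).
    apply -> Rle_div_r; [| lra].
    assert ((1 + x) ^ 2 <= 4 * (1 + x / 2) ^ 2) by nra.
    assert (x <= (1 + x / 2) ^ 2) by nra.
    replace (4 * (1 + x / 2) ^ 4) with (4 * (1 + x / 2) ^ 2 * (1 + x / 2) ^ 2) by ring.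
    apply Rmult_le_compat; [apply pow2_ge_0 | lra | assumption | assumption]. }
  rewrite Rabs_pos_eq by (apply Rmult_le_pos; [apply Rmult_le_pos |]; lra).
  replace (4 * (K1 * K2) / x) with (K1 * K2 * (4 / x)) by (field; lra).
  apply Rmult_le_compat; [apply Rmult_le_pos; lra | lra | | lra].
  apply Rmult_le_compat; lra. }
generalize (vanishes_plus _ _ (vanishes_plus _ _ V1 V2) V3).
unfold profile; intros V eps Heps; generalize (V eps Heps).
apply filter_imp; intros x Hx; eapply Rle_lt_trans, Hx; right; f_equal.
unfold rescaled; rewrite (survival_convolve x H1 H2 F1); ring.
Qed.

(** * From tail profiles to the classes [L(g)] and [S(g)] *)

Lemma asymp_of_scaled_limit (s u v : R -> R) (l : R) : 0 < l -> (forall x, 0 < x -> 0 < s x) ->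
  vanishes (fun x => s x * u x - l) -> vanishes (fun x => s x * v x - l) -> asymp u v.
Proof.
intros Hl Hs Hu Hv eps Heps.
(* The minimum with [1] keeps [s x * v x] above [l / 2]; two errors of this size add up to at most
   [eps * l / 2], which is below [eps * (s x * v x)]. *)
assert (He : 0 < Rmin 1 eps * l / 4).
{ apply Rdiv_lt_0_compat; [apply Rmult_lt_0_compat; [apply Rmin_pos |] |]; lra. }
destruct (filter_and _ _ (Hu _ He) (Hv _ He)) as [M HM].
exists (Rmax 0 M); intros x Hx.
pose proof (Rmax_l 0 M); pose proof (Rmax_r 0 M).
destruct (HM x ltac:(lra)) as [H1 H2]; specialize (Hs x ltac:(lra)).
apply Rabs_def2 in H1; apply Rabs_def2 in H2.
pose proof (Rmin_l 1 eps); pose proof (Rmin_r 1 eps).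
assert (Hmin : Rmin 1 eps * l <= 1 * l) by (apply Rmult_le_compat_r; lra).
assert (Hmin' : Rmin 1 eps * l <= eps * l) by (apply Rmult_le_compat_r; lra).
assert (Hsv : l / 2 < s x * v x) by lra.
assert (Hv0 : 0 < v x) by nra.
replace (u x / v x - 1) with ((s x * u x - s x * v x) / (s x * v x)) by (field; lra).
unfold Rdiv; rewrite Rabs_mult, (Rabs_pos_eq (/ _)) by (left; apply Rinv_0_lt_compat; lra).
apply Rlt_div_l; [lra |].
apply Rlt_le_trans with (eps * (l / 2)); [apply Rabs_def1; lra | nra].
Qed.

(** A shift by [a] multiplies a constant profile by [exp (- g * a)], which is membership in [L(g)];
    self-convolution multiplies it by [2 * m], which is the remaining condition of [S(g)]. *)
Lemma inS_of_constant_profile {g c : R} {E : (R -> R) -> R} (HE : expectation g E) :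
  0 < g -> 0 < c -> fubini g E -> profile g E (fun _ => c) -> inS g (distr_of HE).
Proof.
intros Hg Hc HF Hprof.
assert (Hbound : forall x : R, Rabs ((fun _ => c) x) <= c) by (intros; rewrite Rabs_pos_eq; lra).
assert (Hs : forall x, 0 < x -> 0 < exp (g * x) * (1 + x) ^ 2).
{ intros x Hx; apply Rmult_lt_0_compat; [apply exp_pos | apply pow_lt; lra]. }
assert (Hm : 0 < E (fun y => exp (g * y))) by exact (expect_exp_pos HE).
split; [split |].
(* The profile yields positivity of the tail only far out, at [y]; monotonicity carries it back to
   every [x]. *)
- intros x; destruct (Hprof c Hc) as [M HM].
  pose proof (Rmax_l x (Rmax M 0)); pose proof (Rmax_r x (Rmax M 0)).
  pose proof (Rmax_l M 0); pose proof (Rmax_r M 0).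
  set (y := Rmax x (Rmax M 0) + 1) in *.
  apply Rlt_le_trans with (survival E y); [| apply (survival_antitone HE); unfold y; lra].
  assert (Hy : M < y) by (unfold y; lra).
  specialize (HM y Hy); apply Rabs_def2 in HM; unfold rescaled in HM.
  specialize (Hs y ltac:(unfold y; lra)); nra.
- intros a; change (asymp (fun x => survival E (x + a)) (fun x => exp (- g * a) * survival E x)).
  pose proof (exp_pos (- g * a)) as Hea.
  apply (asymp_of_scaled_limit (fun x => exp (g * x) * (1 + x) ^ 2) _ _ (exp (- g * a) * c));
    [nra | exact Hs | |].
  + apply (vanishes_le _ _ (vanishes_scal_abs _ _ (Rlt_le _ _ Hea)
      (profile_shift (- a) Hg HE Hbound Hprof))).
    exists (- a); intros x Hx; right.
    replace (x + a) with (x - - a) by ring.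
    rewrite rescaled_shift by lra.
    replace (g * - a) with (- g * a) by ring.
    rewrite <- Rmult_minus_distr_l, Rabs_mult, (Rabs_pos_eq (exp _)) by lra; reflexivity.
  + apply (vanishes_le _ _ (vanishes_scal_abs _ _ (Rlt_le _ _ Hea) Hprof)).
    exists 0; intros x _; right; unfold rescaled.
    rewrite <- (Rabs_pos_eq (exp (- g * a)) (Rlt_le _ _ Hea)) at 3; rewrite <- Rabs_mult.
    f_equal; ring.
- set (m := E (fun y => exp (g * y))) in *; exists m; split; [apply laplace_is_distr_of |].
  exists (distr_of (expectation_convolve g E E HE HE)); split; [apply is_conv_distr_of |].
  change (asymp (survival (convolve E E)) (fun x => 2 * m * survival E x)).
  apply (asymp_of_scaled_limit (fun x => exp (g * x) * (1 + x) ^ 2) _ _ (2 * m * c));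
    [nra | exact Hs | |].
  + generalize (profile_convolve Hg HE HE HF Hbound Hbound Hprof Hprof); unfold profile.
    assert (Hmc : E (fun y => exp (g * y) * c) = m * c).
    { unfold m; rewrite Rmult_comm, <- (expect_scal _ _ HE) by apply dominated_exp.
      f_equal; apply functional_extensionality; intros; ring. }
    rewrite Hmc; replace (m * c + m * c) with (2 * m * c) by ring; trivial.
  + assert (H2m : 0 <= 2 * m) by lra.
    apply (vanishes_le _ _ (vanishes_scal_abs _ _ H2m Hprof)).
    exists 0; intros x _; right; unfold rescaled.
    rewrite <- (Rabs_pos_eq (2 * m) H2m) at 3; rewrite <- Rabs_mult; f_equal; ring.
Qed.

Definition wave (g c x : R) : R := c * (2 + cos (g * x)).

Lemma wave_bounded (g c x : R) : 0 < c -> Rabs (wave g c x) <= 3 * c.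
Proof.
intros Hc; unfold wave; pose proof (COS_bound (g * x)).
rewrite Rabs_pos_eq; nra.
Qed.

(** The vanishing of the transform at [g + i g] wipes out the oscillation of the tail. *)
Lemma profile_convolve_wave {g c : R} {E : (R -> R) -> R} :
  0 < g -> 0 < c -> expectation g E -> fubini g E -> profile g E (wave g c) ->
  E (fun y => exp (g * y) * cos (g * y)) = 0 ->
  E (fun y => exp (g * y) * sin (g * y)) = 0 ->
  profile g (convolve E E) (fun _ => 4 * c * E (fun y => exp (g * y))).
Proof.
intros Hg Hc HE HF Hprof Hcos Hsin.
assert (Hb : forall x, Rabs (wave g c x) <= 3 * c) by (intros; now apply wave_bounded).
assert (HI : forall x, E (fun y => exp (g * y) * wave g c (x - y)) =
   2 * c * E (fun y => exp (g * y))).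
{ intros x.
  assert (D1 : dominated g (fun y => exp (g * y) * cos (g * y))).
  { apply dominated_exp_mult with 1; intros y; apply Rabs_le, COS_bound. }
  assert (D2 : dominated g (fun y => exp (g * y) * sin (g * y))).
  { apply dominated_exp_mult with 1; intros y; apply Rabs_le, SIN_bound. }
  (* The addition formula for [cos (g * x - g * y)] separates [x] from [y], leaving exactly the two
     vanishing expectations as coefficients. *)
  transitivity (E (fun y => 2 * c * exp (g * y) +
    (c * cos (g * x) * (exp (g * y) * cos (g * y))
     + c * sin (g * x) * (exp (g * y) * sin (g * y))))).
  - f_equal; apply functional_extensionality; intros y; unfold wave.
    replace (g * (x - y)) with (g * x - g * y) by ring; rewrite cos_minus; ring.
  - rewrite (expect_plus _ _ HE), (expect_plus _ _ HE), !(expect_scal _ _ HE), Hcos, Hsin;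
      auto using dominated_plus, dominated_scal, dominated_exp; ring. }
generalize (profile_convolve Hg HE HE HF Hb Hb Hprof Hprof); unfold profile.
intros V eps Heps; generalize (V eps Heps); apply filter_imp; intros x Hx.
rewrite !HI in Hx.
replace (4 * c * E (fun y => exp (g * y))) with
  (2 * c * E (fun y => exp (g * y)) + 2 * c * E (fun y => exp (g * y))) by ring; exact Hx.
Qed.

(** Half a period apart the profile takes the values [3 * c] and [c], so the ratio of the rescaled
    tails returns near [1 / 3] infinitely often, while membership in [L(g)] would force it to tend
    to [1]. *)
Lemma not_inL_of_wave_profile {g c : R} {E : (R -> R) -> R} (HE : expectation g E) :
  0 < g -> 0 < c -> profile g E (wave g c) -> ~ inL g (distr_of HE).
Proof.
intros Hg Hc Hprof [_ HL].
set (a := PI / g); pose proof PI_RGT_0 as HPI.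
assert (Ha : 0 < a) by now apply Rdiv_lt_0_compat.
destruct (HL a (1 / 3) ltac:(lra)) as [M1 HM1].
destruct (Hprof (c / 2) ltac:(lra)) as [M2 HM2].
set (L := Rmax 0 (Rmax M1 M2)).
assert (HLl : 0 <= L /\ M1 <= L /\ M2 <= L).
{ unfold L; pose proof (Rmax_l 0 (Rmax M1 M2)); pose proof (Rmax_r 0 (Rmax M1 M2)).
  pose proof (Rmax_l M1 M2); pose proof (Rmax_r M1 M2); lra. }
destruct (nfloor_ex (L / a)) as [k Hk].
{ apply Rmult_le_pos; [lra | left; now apply Rinv_0_lt_compat]. }
set (x := 2 * INR (S k) * a).
assert (Hx : L < x).
{ destruct Hk as [_ Hk]; apply Rlt_div_l in Hk; [| lra].
  unfold x; rewrite S_INR; pose proof (pos_INR k); nra. }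
assert (Hgx : g * x = 0 + 2 * INR (S k) * PI) by (unfold x, a; field; lra).
assert (Hgxa : g * (x + a) = 0 + 2 * INR (S k) * PI + PI) by (unfold x, a; field; lra).
pose proof (HM2 x ltac:(lra)) as B1; pose proof (HM2 (x + a) ltac:(lra)) as B2.
unfold wave in B1, B2.
rewrite Hgx, cos_period, cos_0 in B1; rewrite Hgxa, neg_cos, cos_period, cos_0 in B2.
apply Rabs_def2 in B1; apply Rabs_def2 in B2.
specialize (HM1 x ltac:(lra)).
change (Rabs (survival E (x + a) / (exp (- g * a) * survival E x) - 1) < 1 / 3) in HM1.
assert (Hs : 0 < exp (g * x) * (1 + x) ^ 2)
  by (apply Rmult_lt_0_compat; [apply exp_pos | apply pow_lt; lra]).
pose proof (exp_pos (- g * a)) as Hea.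
assert (HR : survival E (x + a) / (exp (- g * a) * survival E x) =
  ((1 + x) / (1 + x - - a)) ^ 2 * rescaled g E (x + a) / rescaled g E x).
{ pose proof (rescaled_shift g E x (- a) ltac:(lra)) as Hsh.
  replace (x - - a) with (x + a) in Hsh by ring.
  replace (g * - a) with (- g * a) in Hsh by ring.
  assert (Hne : survival E x <> 0).
  { intros H0; unfold rescaled in B1; rewrite H0 in B1; lra. }
  assert (Hne' : rescaled g E x <> 0) by lra.
  apply Rmult_eq_reg_l with (exp (- g * a) * rescaled g E x); [| nra].
  transitivity (exp (- g * a) * (((1 + x) / (1 + x - - a)) ^ 2 * rescaled g E (x + a)));
    [| field; split; lra].
  rewrite <- Hsh; unfold rescaled; field; split; lra. }
rewrite HR in HM1; apply Rabs_def2 in HM1.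
assert (Hr : 0 <= (1 + x) / (1 + x - - a) <= 1).
{ split; [apply Rmult_le_pos; [| left; apply Rinv_0_lt_compat]; lra |].
  apply <- Rle_div_l; lra. }
(* The errors of [c / 2] leave at most [3 c / 2] over [5 c / 2], that is [3 / 5]; this contradicts
   the lower bound [1 - 1 / 3] obtained from [HM1]. *)
assert (Hlt : ((1 + x) / (1 + x - - a)) ^ 2 * rescaled g E (x + a) / rescaled g E x < 2 / 3).
{ apply <- Rlt_div_l; [| lra].
  assert (0 <= ((1 + x) / (1 + x - - a)) ^ 2 <= 1) by nra.
  nra. }
lra.
Qed.

(** * The oscillating distribution *)

Lemma cos_lipschitz (a b : R) : Rabs (cos b - cos a) <= Rabs (b - a).
Proof.
destruct (MVT_abs cos (fun x => - sin x) a b) as [c [Hc _]].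
{ intros x _; apply derivable_pt_lim_cos. }
rewrite Hc, Rabs_Ropp; rewrite <- (Rmult_1_l (Rabs (b - a))) at 2.
apply Rmult_le_compat_r; [apply Rabs_pos | apply Rabs_le, SIN_bound].
Qed.

Definition target_tail (g s : R) : R := exp (- (g * s)) * (2 + cos (g * s)) / (1 + s) ^ 2.

Lemma target_tail_pos (g s : R) : 0 <= s -> 0 < target_tail g s.
Proof.
intros Hs; unfold target_tail; pose proof (COS_bound (g * s)).
apply Rdiv_lt_0_compat; [| apply pow_lt; lra].
apply Rmult_lt_0_compat; [apply exp_pos | lra].
Qed.

Lemma exp_mult_target_tail_le (g s : R) : 0 <= s ->
  exp (g * s) * target_tail g s <= 3 / (1 + s) ^ 2.
Proof.
intros Hs; unfold target_tail; pose proof (COS_bound (g * s)).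
replace (exp (g * s) * (exp (- (g * s)) * (2 + cos (g * s)) / (1 + s) ^ 2))
  with ((exp (g * s) * exp (- (g * s))) * ((2 + cos (g * s)) / (1 + s) ^ 2)) by (field; lra).
rewrite <- exp_plus, Rplus_opp_r, exp_0, Rmult_1_l.
apply Rmult_le_compat_r; [left; apply Rinv_0_lt_compat, pow_lt |]; lra.
Qed.

(** With [h = g * (t - s)], going back from [t] to [s] multiplies the exponential by
    [exp h >= 1 + h], while the cosine changes by at most [h]. As [2 + cos >= 1], the exponential
    gain outweighs that change. *)
Lemma target_tail_antitone (g s t : R) : 0 < g -> 0 <= s <= t ->
  target_tail g t <= target_tail g s.
Proof.
intros Hg Hst; unfold target_tail, Rdiv.
pose proof (COS_bound (g * s)); pose proof (COS_bound (g * t)).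
apply Rmult_le_compat.
- apply Rmult_le_pos; [left; apply exp_pos | lra].
- left; apply Rinv_0_lt_compat, pow_lt; lra.
- set (h := g * (t - s)).
  assert (Hh : 0 <= h) by (apply Rmult_le_pos; lra).
  replace (- (g * s)) with (- (g * t) + h) by (unfold h; ring).
  rewrite exp_plus, Rmult_assoc; apply Rmult_le_compat_l; [left; apply exp_pos |].
  pose proof (cos_lipschitz (g * s) (g * t)) as Hc.
  replace (g * t - g * s) with h in Hc by (unfold h; ring).
  rewrite (Rabs_pos_eq h) in Hc by assumption; apply Rabs_le_between in Hc.
  pose proof (exp_ineq1_le h); nra.
- apply Rinv_le_contravar; [apply pow_lt; lra | apply pow_incr; lra].
Qed.

(** * Discretising the target tail on the points [sqrt n] *)

Definition grid_tail (g : R) (n : nat) : R := target_tail g (sqrt (INR n)).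

(** The mass at [sqrt n], chosen so that the mass of [[sqrt N, oo)] telescopes to the target tail at
    [sqrt N]. *)
Definition grid_mass (g : R) (n : nat) : R := grid_tail g n - grid_tail g (S n).

Lemma sqrt_INR_S (n : nat) : sqrt (INR n) <= sqrt (INR (S n)).
Proof. apply sqrt_le_1_alt, le_INR; lia. Qed.

Lemma grid_mass_nonneg (g : R) (n : nat) : 0 < g -> 0 <= grid_mass g n.
Proof.
intros Hg; unfold grid_mass, grid_tail.
enough (target_tail g (sqrt (INR (S n))) <= target_tail g (sqrt (INR n))) by lra.
apply target_tail_antitone; [assumption | split; [apply sqrt_pos | apply sqrt_INR_S]].
Qed.

Lemma grid_tail_lim (g : R) : 0 < g -> is_lim_seq (grid_tail g) 0.
Proof.
intros Hg; apply is_lim_seq_spec; intros eps.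
destruct (nfloor_ex (3 / eps)) as [N HN].
{ left; apply Rdiv_lt_0_compat; [lra | apply cond_pos]. }
exists N; intros n Hn; pose proof (sqrt_pos (INR n)) as Hs.
pose proof (target_tail_pos g _ Hs) as Hpos.
unfold grid_tail; rewrite Rminus_0_r, Rabs_pos_eq by lra.
eapply Rle_lt_trans with (3 / (1 + sqrt (INR n)) ^ 2).
- eapply Rle_trans, (exp_mult_target_tail_le g _ Hs).
  assert (0 <= g * sqrt (INR n)) by (apply Rmult_le_pos; lra).
  pose proof (exp_ineq1_le (g * sqrt (INR n))); nra.
- assert (Hsq : sqrt (INR n) * sqrt (INR n) = INR n) by apply sqrt_sqrt, pos_INR.
  apply <- Rlt_div_l; [| apply pow_lt; lra].
  apply le_INR in Hn; destruct HN as [_ HN].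
  apply Rlt_div_l in HN; [| apply cond_pos].
  pose proof (cond_pos eps).
  apply Rlt_le_trans with (1 := HN); rewrite Rmult_comm.
  apply Rmult_le_compat_l; nra.
Qed.

Lemma is_series_grid_mass_from (g : R) (N : nat) : 0 < g ->
  is_series (fun n => grid_mass g n * ind (N <= n)%nat) (grid_tail g N).
Proof.
intros Hg.
change (is_lim_seq (sum_n (fun n => grid_mass g n * ind (N <= n)%nat)) (grid_tail g N)).
apply is_lim_seq_ext_loc with (fun n => grid_tail g N - grid_tail g (S n)).
- exists N; intros n Hn; rewrite sum_n_Reals.
  (* The minimum covers the partial sums that stop before index [N], which are [0]. *)
  assert (H : forall k, sum_f_R0 (fun n => grid_mass g n * ind (N <= n)%nat) k
     = grid_tail g (Nat.min N (S k)) - grid_tail g (S k)).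
  { induction k as [|k IH]; cbn [sum_f_R0]; [| rewrite IH].
    - destruct N as [|[|N]].
      + rewrite ind_true by lia; unfold grid_mass; simpl; ring.
      + rewrite ind_false by lia; simpl; ring.
      + rewrite ind_false by lia; simpl; ring.
    - destruct (Nat.le_gt_cases N (S k)).
      + rewrite ind_true, !Nat.min_l by lia; unfold grid_mass; ring.
      + rewrite ind_false, !Nat.min_r by lia; ring. }
  rewrite H, Nat.min_l by lia; reflexivity.
- replace (Finite (grid_tail g N)) with (Finite (grid_tail g N - 0)) by (f_equal; ring).
  apply is_lim_seq_minus'; [apply is_lim_seq_const |].
  apply (is_lim_seq_incr_1 (grid_tail g)); now apply grid_tail_lim.
Qed.

Lemma ex_series_nonneg_bounded (a : nat -> R) (M : R) : (forall n, 0 <= a n) ->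
  (forall n, sum_f_R0 a n <= M) -> ex_series a.
Proof.
intros Ha HM; destruct (ex_finite_lim_seq_incr (sum_n a) M) as [l Hl].
- intros n; rewrite sum_Sn; unfold plus; simpl; specialize (Ha (S n)); lra.
- intros n; rewrite sum_n_Reals; apply HM.
- now exists l.
Qed.

(** Summation by parts, with [1 / (1 + s)] as an antiderivative for [1 / (1 + s)^2]. *)
Lemma ex_series_grid_moment (g : R) : 0 < g ->
  ex_series (fun n => grid_mass g n * exp (g * sqrt (INR n))).
Proof.
intros Hg.
(* [T n] bounds the sum from index [n] on. Its first term is the boundary term of the summation by
   parts; in the second, [3] is the bound of [2 + cos]. *)
pose (T := fun n => exp (g * sqrt (INR n)) * grid_tail g n + 3 * g / (1 + sqrt (INR n))).
assert (HT : forall n, 0 <= T n).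
{ intros n; unfold T, grid_tail; pose proof (sqrt_pos (INR n)) as Hs.
  pose proof (target_tail_pos g _ Hs); pose proof (exp_pos (g * sqrt (INR n))).
  apply Rplus_le_le_0_compat; [nra |].
  apply Rmult_le_pos; [nra | left; apply Rinv_0_lt_compat; lra]. }
assert (Hstep : forall n, grid_mass g n * exp (g * sqrt (INR n)) <= T n - T (S n)).
{ intros n; unfold T, grid_mass.
  pose proof (sqrt_pos (INR n)) as Hs; pose proof (sqrt_INR_S n) as Ht.
  unfold grid_tail; revert Hs Ht; generalize (sqrt (INR n)), (sqrt (INR (S n))); intros s t Hs Ht.
  enough ((exp (g * t) - exp (g * s)) * target_tail g t <= 3 * g / (1 + s) - 3 * g / (1 + t))
    by lra.
  assert (Hexp : exp (g * t) - exp (g * s) <= exp (g * t) * (g * (t - s))).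
  { replace (g * s) with (g * t + - (g * (t - s))) by ring.
    rewrite exp_plus; pose proof (exp_pos (g * t)).
    pose proof (exp_ineq1_le (- (g * (t - s)))); nra. }
  pose proof (target_tail_pos g t ltac:(lra)) as Hpos.
  apply Rle_trans with (exp (g * t) * target_tail g t * (g * (t - s))); [nra |].
  apply Rle_trans with (3 / (1 + t) ^ 2 * (g * (t - s))).
  { apply Rmult_le_compat_r; [apply Rmult_le_pos; lra | apply exp_mult_target_tail_le; lra]. }
  replace (3 * g / (1 + s) - 3 * g / (1 + t)) with (3 / ((1 + s) * (1 + t)) * (g * (t - s)))
    by (field; lra).
  apply Rmult_le_compat_r; [apply Rmult_le_pos; lra |].
  apply Rmult_le_compat_l; [lra |].
  apply Rinv_le_contravar; nra. }
apply ex_series_nonneg_bounded with (T 0%nat).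
- intros n; apply Rmult_le_pos; [now apply grid_mass_nonneg | left; apply exp_pos].
- intros n.
  enough (sum_f_R0 (fun n => grid_mass g n * exp (g * sqrt (INR n))) n <= T 0%nat - T (S n))
    by (specialize (HT (S n)); lra).
  induction n as [|n IH]; cbn [sum_f_R0]; [apply Hstep |].
  specialize (Hstep (S n)); lra.
Qed.

(** * Adding four atoms and normalising *)

Definition prepend4 {A : Type} (a0 a1 a2 a3 : A) (a : nat -> A) (n : nat) : A :=
  match n with
  | 0 => a0 | 1 => a1 | 2 => a2 | 3 => a3 | S (S (S (S k))) => a k
  end.

Lemma is_series_cons (a : nat -> R) (l : R) :
  is_series (fun k => a (S k)) l -> is_series a (a 0%nat + l).
Proof.
intros H; apply is_series_decr_1; unfold plus, opp; simpl.
replace (a 0%nat + l + - a 0%nat) with l by ring; exact H.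
Qed.

Lemma is_series_prepend4 (a : nat -> R) (l : R) : is_series (fun k => a (S (S (S (S k))))) l ->
  is_series a (a 0%nat + (a 1%nat + (a 2%nat + (a 3%nat + l)))).
Proof.
intros H.
apply is_series_cons, (is_series_cons (fun k => a (S k))),
  (is_series_cons (fun k => a (S (S k)))), (is_series_cons (fun k => a (S (S (S k))))), H.
Qed.

(** Applied with [s x] the first grid point [sqrt n] above [x]. *)
Lemma target_tail_vanishing_error (g : R) (s : R -> R) : 0 < g ->
  (forall x, 0 < x -> x <= s x <= x + / x) ->
  vanishes (fun x => exp (g * x) * (1 + x) ^ 2 * target_tail g (s x) - (2 + cos (g * x))).
Proof.
(* With [h] the distance from [x] to [s x], the change of the factor in front costs [(g + 2) * h]
   times the bound [3] of [2 + cos], and the change of the cosine costs [g * h]; together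
   [(4 * g + 6) * h], with [h <= / x]. *)
intros Hg Hs; apply vanishes_le with (fun x => (4 * g + 6) / x); [apply vanishes_inv |].
exists 0; intros x Hx; specialize (Hs x Hx).
set (t := s x) in *; set (h := t - x).
assert (Hh : 0 <= h <= / x) by (unfold h; lra).
pose (q := exp (- (g * h)) * ((1 + x) / (1 + t)) ^ 2).
replace (exp (g * x) * (1 + x) ^ 2 * target_tail g t) with (q * (2 + cos (g * t))).
2: { unfold q, target_tail, h.
  replace (- (g * (t - x))) with (g * x + - (g * t)) by ring.
  rewrite exp_plus; field; lra. }
assert (Hgh : 0 <= g * h) by (apply Rmult_le_pos; lra).
assert (Hr : 0 <= 1 - (1 + x) / (1 + t) <= h).
{ replace (1 - (1 + x) / (1 + t)) with (h / (1 + t)) by (unfold h; field; lra).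
  split; [apply Rmult_le_pos; [| left; apply Rinv_0_lt_compat]; lra |].
  apply <- Rle_div_l; [nra | lra]. }
assert (Hr0 : 0 <= (1 + x) / (1 + t))
  by (apply Rmult_le_pos; [| left; apply Rinv_0_lt_compat]; lra).
assert (He : 1 - g * h <= exp (- (g * h)) <= 1).
{ split; [pose proof (exp_ineq1_le (- (g * h))); lra |].
  rewrite <- exp_0; apply exp_le_compat; lra. }
pose proof (exp_pos (- (g * h))) as Hep.
assert (Hq : 0 <= 1 - q <= g * h + 2 * h).
{ unfold q; set (r := (1 + x) / (1 + t)) in *; set (e := exp _) in *.
  assert (0 <= 1 - r ^ 2 <= 2 * h) by nra.
  replace (1 - e * r ^ 2) with ((1 - e) + e * (1 - r ^ 2)) by ring; nra. }
pose proof (cos_lipschitz (g * x) (g * t)) as Hc.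
replace (g * t - g * x) with (g * h) in Hc by (unfold h; ring).
rewrite (Rabs_pos_eq (g * h)) in Hc by assumption; apply Rabs_le_between in Hc.
pose proof (COS_bound (g * t)) as Hb.
apply Rle_trans with ((4 * g + 6) * h); [| apply Rmult_le_compat_l; lra].
replace (q * (2 + cos (g * t)) - (2 + cos (g * x)))
  with (- ((1 - q) * (2 + cos (g * t))) + (cos (g * t) - cos (g * x))) by ring.
assert (0 <= (1 - q) * (2 + cos (g * t)) <= (g * h + 2 * h) * 3).
{ split; [apply Rmult_le_pos; lra | apply Rmult_le_compat; lra]. }
apply Rabs_le; lra.
Qed.

Lemma exists_wave_distribution (g : R) : 0 < g ->
  exists (E : (R -> R) -> R) (c : R), 0 < c /\ expectation g E /\ fubini g E /\
    profile g E (wave g c) /\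
    E (fun y => exp (g * y) * cos (g * y)) = 0 /\
    E (fun y => exp (g * y) * sin (g * y)) = 0.
Proof.
intros Hg; pose proof PI_RGT_0 as HPI.
pose (d := grid_mass g); pose (s := fun n => sqrt (INR n)).
assert (Hd : forall n, 0 <= d n) by (intros; now apply grid_mass_nonneg).
assert (Hmom : ex_series (fun n => d n * exp (g * s n))) by now apply ex_series_grid_moment.
assert (Hosc : forall p : R -> R, (forall y, -1 <= p y <= 1) ->
  is_series (fun n => d n * (exp (g * s n) * p (g * s n)))
    (Series (fun n => d n * (exp (g * s n) * p (g * s n))))).
{ intros p Hp; apply Series_correct.
  apply @ex_series_le with (2 := Hmom); intros n.
  unfold norm; simpl; unfold abs; simpl.
  rewrite <- Rmult_assoc, Rabs_mult, Rabs_pos_eq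
    by (apply Rmult_le_pos; [apply Hd | left; apply exp_pos]).
  rewrite <- (Rmult_1_r (d n * exp (g * s n))) at 2.
  apply Rmult_le_compat_l; [apply Rmult_le_pos; [apply Hd | left; apply exp_pos] |].
  apply Rabs_le, Hp. }
pose proof (Hosc cos COS_bound) as Hu; pose proof (Hosc sin SIN_bound) as Hv.
set (u := Series _) in Hu; set (v := Series _) in Hv.
(* Negative and positive parts of [u] sit at the angles [0] and [PI], those of [v] at [PI / 2] and
   [3 * (PI / 2)], so the atoms contribute [- u] and [- v] with nonnegative masses. The exponentials
   offset the factor [exp (g * y)] at each atom. *)
pose (b0 := (Rabs u - u) / 2); pose (b1 := (Rabs v - v) / 2 * exp (- (PI / 2))).
pose (b2 := (Rabs u + u) / 2 * exp (- PI)); pose (b3 := (Rabs v + v) / 2 * exp (- (3 * (PI / 2)))).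
assert (Hb : 0 <= b0 /\ 0 <= b1 /\ 0 <= b2 /\ 0 <= b3).
{ pose proof (Rle_abs u); pose proof (Rle_abs (- u)) as Hu'; rewrite Rabs_Ropp in Hu'.
  pose proof (Rle_abs v); pose proof (Rle_abs (- v)) as Hv'; rewrite Rabs_Ropp in Hv'.
  unfold b0, b1, b2, b3; repeat split; try lra;
    (apply Rmult_le_pos; [lra | left; apply exp_pos]). }
(* The total mass before normalisation: the grid masses sum to the target tail at [0], which is
   [3]. *)
pose (M := b0 + (b1 + (b2 + (b3 + 3)))).
assert (HM : 0 < M) by (unfold M; lra).
pose (w := fun n => prepend4 b0 b1 b2 b3 d n * / M).
pose (z := prepend4 0 (PI / 2 / g) (PI / g) (3 * (PI / 2) / g) s).
assert (Hw : forall n, 0 <= w n).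
{ intros n; apply Rmult_le_pos; [| left; now apply Rinv_0_lt_compat].
  destruct n as [|[|[|[|n]]]]; simpl; try tauto; apply Hd. }
assert (Hser : forall (f : R -> R) (L : R), is_series (fun n => d n * f (s n)) L ->
  is_series (fun n => w n * f (z n))
    ((b0 * f 0 + (b1 * f (PI / 2 / g) + (b2 * f (PI / g) + (b3 * f (3 * (PI / 2) / g) + L)))) * / M)).
{ intros f L HL.
  apply is_series_ext with (fun n => prepend4 b0 b1 b2 b3 d n * f (z n) * / M).
  { assert (H : forall a b c : R, a * b * c = a * c * b) by (intros; ring); intros n; apply H. }
  apply is_series_scal_r.
  apply (is_series_prepend4 (fun n => prepend4 b0 b1 b2 b3 d n * f (z n))), HL. }
assert (Hsum3 : is_series (fun n => d n * 1) 3).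
{ replace 3 with (grid_tail g 0).
  - apply is_series_ext with (2 := is_series_grid_mass_from g 0 Hg).
    intros n; rewrite ind_true by lia; reflexivity.
  - unfold grid_tail, target_tail; simpl; rewrite sqrt_0, Rmult_0_r, Ropp_0, exp_0, cos_0; field. }
assert (Hsum : is_series w 1).
{ apply is_series_ext with (fun n => w n * (fun _ => 1) (z n)); [intros n; apply Rmult_1_r |].
  assert (H : (b0 * 1 + (b1 * 1 + (b2 * 1 + (b3 * 1 + 3)))) * / M = 1)
    by (unfold M in *; field; lra).
  pose proof (Hser (fun _ => 1) 3 Hsum3) as HS; cbv beta in HS; rewrite H in HS; exact HS. }
assert (Hwmom : ex_series (fun n => w n * exp (g * z n))).
{ destruct Hmom as [L HL]; eexists; exact (Hser (fun y => exp (g * y)) L HL). }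
assert (G1 : g * (PI / 2 / g) = PI / 2) by (field; lra).
assert (G2 : g * (PI / g) = PI) by (field; lra).
assert (G3 : g * (3 * (PI / 2) / g) = 3 * (PI / 2)) by (field; lra).
assert (Hcancel : forall a t, a * exp (- t) * exp t = a).
{ intros a t; rewrite Rmult_assoc, <- exp_plus, Rplus_opp_l, exp_0; ring. }
exists (atomic w z), (/ M); split; [now apply Rinv_0_lt_compat |].
split; [now apply expectation_atomic |]; split; [now apply fubini_atomic |].
split; [| split].
(* For [x > 0], the index of the first grid point strictly beyond [x], namely the integer part of
   [x * x] plus one. The default [0] sits in a branch that cannot occur, a square being
   nonnegative. *)
- pose (N := fun x => match Rle_dec 0 (x * x) with
    | left H => S (proj1_sig (nfloor_ex (x * x) H)) | right _ => 0%nat end).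
  assert (HN : forall x, x * x < INR (N x) <= x * x + 1).
  { intros x; unfold N; destruct (Rle_dec 0 (x * x)) as [H|H]; [| exfalso; nra].
    destruct (nfloor_ex (x * x) H) as [n Hn]; cbn [proj1_sig]; rewrite S_INR; lra. }
  assert (Hs : forall x, 0 < x -> forall n, x < s n <-> (N x <= n)%nat).
  { intros x Hx n; specialize (HN x).
    assert (Hsq : sqrt (INR n) * sqrt (INR n) = INR n) by apply sqrt_sqrt, pos_INR.
    pose proof (sqrt_pos (INR n)) as Hsp; unfold s; split; intros H.
    - unfold N in *; destruct (Rle_dec 0 (x * x)) as [H'|H']; [| lia].
      destruct (nfloor_ex (x * x) H') as [k Hk]; cbn [proj1_sig] in *.
      apply INR_lt; nra.
    - apply le_INR in H; nra. }
  (* Beyond the last of the four atoms only grid points contribute, and these telescope. *)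
  assert (Htail : forall x, 3 * (PI / 2) / g < x ->
    survival (atomic w z) x = target_tail g (s (N x)) * / M).
  { intros x Hx.
    assert (Hx0 : 0 < PI / 2 / g /\ PI / 2 / g < PI / g /\ PI / g < 3 * (PI / 2) / g).
    { repeat split; unfold Rdiv; try (apply Rmult_lt_0_compat; [lra |]);
        try (apply Rmult_lt_compat_r; [| lra]); now apply Rinv_0_lt_compat. }
    unfold survival, atomic; apply is_series_unique.
    replace (target_tail g (s (N x)) * / M) with
      ((b0 * ind (x < 0) + (b1 * ind (x < PI / 2 / g) + (b2 * ind (x < PI / g)
        + (b3 * ind (x < 3 * (PI / 2) / g) + target_tail g (s (N x)))))) * / M)
      by (rewrite !ind_false by lra; ring).
    apply (Hser (fun y => ind (x < y))).
    apply is_series_ext with (2 := is_series_grid_mass_from g (N x) Hg).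
    intros n; unfold d; f_equal; apply ind_iff; symmetry; apply Hs; lra. }
  assert (Herr : vanishes (fun x =>
    exp (g * x) * (1 + x) ^ 2 * target_tail g (s (N x)) - (2 + cos (g * x)))).
  { apply (target_tail_vanishing_error g (fun x => s (N x)) Hg).
    intros x Hx; split; [left; now apply Hs |].
    pose proof (Rinv_0_lt_compat x Hx) as Hi.
    unfold s; rewrite <- (sqrt_square (x + / x)) by lra.
    apply sqrt_le_1_alt; specialize (HN x).
    assert (x * / x = 1) by (apply Rinv_r; lra); nra. }
  assert (HiM : 0 < / M) by now apply Rinv_0_lt_compat.
  apply (vanishes_le _ _ (vanishes_scal_abs _ _ (Rlt_le _ _ HiM) Herr)).
  exists (3 * (PI / 2) / g); intros x Hx; right.
  unfold rescaled, wave; rewrite Htail by assumption.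
  rewrite <- (Rabs_pos_eq (/ M) (Rlt_le _ _ HiM)) at 3; rewrite <- Rabs_mult; f_equal; ring.
- unfold atomic; apply is_series_unique.
  replace 0 with ((b0 * (exp (g * 0) * cos (g * 0)) + (b1 * (exp (g * (PI / 2 / g)) * cos (g * (PI / 2 / g)))
    + (b2 * (exp (g * (PI / g)) * cos (g * (PI / g)))
    + (b3 * (exp (g * (3 * (PI / 2) / g)) * cos (g * (3 * (PI / 2) / g))) + u)))) * / M).
  + apply (Hser (fun y => exp (g * y) * cos (g * y))), Hu.
  + rewrite G1, G2, G3, Rmult_0_r, exp_0, cos_0, cos_PI2, cos_PI, cos_3PI2.
    pose proof (Hcancel ((Rabs u + u) / 2) PI) as H2; fold b2 in H2.
    replace (b2 * (exp PI * -1)) with (- (b2 * exp PI)) by ring; rewrite H2.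
    unfold b0; field; lra.
- unfold atomic; apply is_series_unique.
  replace 0 with ((b0 * (exp (g * 0) * sin (g * 0)) + (b1 * (exp (g * (PI / 2 / g)) * sin (g * (PI / 2 / g)))
    + (b2 * (exp (g * (PI / g)) * sin (g * (PI / g)))
    + (b3 * (exp (g * (3 * (PI / 2) / g)) * sin (g * (3 * (PI / 2) / g))) + v)))) * / M).
  + apply (Hser (fun y => exp (g * y) * sin (g * y))), Hv.
  + rewrite G1, G2, G3, Rmult_0_r, exp_0, sin_0, sin_PI2, sin_PI, sin_3PI2.
    pose proof (Hcancel ((Rabs v - v) / 2) (PI / 2)) as H1; fold b1 in H1.
    pose proof (Hcancel ((Rabs v + v) / 2) (3 * (PI / 2))) as H3; fold b3 in H3.
    replace (b3 * (exp (3 * (PI / 2)) * -1)) with (- (b3 * exp (3 * (PI / 2)))) by ring.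
    rewrite Rmult_1_r with (r := exp (PI / 2)), H1, H3; field; lra.
Qed.

Theorem theorem1p1 : forall g : R, 0 < g ->
  exists (mu : distr) (n : nat) (rho : distr),
    (1 <= n)%nat /\ convpow mu n rho /\ inS g rho /\ ~ inS g mu.
Proof.
intros g Hg.
destruct (exists_wave_distribution g Hg) as (E & c & Hc & HE & HF & Hprof & Hcos & Hsin).
pose (HEE := expectation_convolve g E E HE HE).
exists (distr_of HE), 2%nat, (distr_of HEE).
split; [auto |]; split; [| split].
- apply convpowS with (distr_of HE); [| apply is_conv_distr_of].
  apply convpow1; intros A _; reflexivity.
- apply (inS_of_constant_profile HEE Hg (c := 4 * c * E (fun y => exp (g * y)))).
  + pose proof (expect_exp_pos HE); nra.
  + now apply fubini_convolve.
  + now apply profile_convolve_wave.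
- intros [HL _]; exact (not_inL_of_wave_profile HE Hg Hc Hprof HL).
Qed.
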